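(* Let $T$ be a densely defined closed antilinear normal operator on a complex Hilbert space $\mathcal{H}$. Then there exists a conjugation $C$ on $\mathcal{H}$ such that $N:=TC$ is a linear normal operator, $T=NC$, $$|N|=|T|\quad\text{and}\quad C|T|C=|T|.$$ If $E_{|T|}$ denotes the spectral measure of $|T|$, then $CE_{|T|}(M)C=E_{|T|}(M)$ for all Borel sets $M$ of $[0,+\infty)$.
   Context: Scalar products are linear in the first variable; operators may be unbounded, with products on natural domains and equalities including domains. A linear normal operator is a densely defined closed linear operator $N$ with $N^*N=NN^*$, and $|N|:=\sqrt{N^*N}$. An operator $T$ on a linear subspace $\mathcal{D}(T)$ is antilinear if $T(\alpha x+\beta y)=\overline{\alpha}\,Tx+\overline{\beta}\,Ty$ for $\alpha,\beta\in\mathbb{C}$. For a densely defined antilinear $T$ on $\mathcal{H}$, the adjoint $T^\dagger$ is the antilinear operator whose domain consists of all $y\in\mathcal{H}$ for which there is $u\in\mathcal{H}$ with $\langle Tx,y\rangle=\langle u,x\rangle$ for all $x\in\mathcal{D}(T)$; then $T^\dagger y:=u$. $T$ is normal if $T^\dagger T=TT^\dagger$. For densely defined closed antilinear $T$, $T^\dagger T$ is a positive self-adjoint linear operator and $|T|:=\sqrt{T^\dagger T}$. A conjugation on $\mathcal{H}$ is an everywhere defined antilinear isometric operator $C$ with $C^2=I$. *)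

(* Defs.v *)
(* A complex Hilbert space is a complete normed
   module [H] over [R[i]] together with a positive definite sesquilinear form
   [dot : {dot H for Num.conj}] (linear in the first variable) such that
   [dot x x = `|x| ^+ 2].

   A possibly unbounded operator in [H] is represented by its graph, a subset
   of [H * H]; equality of operators, domains included, is equality of graphs. *)
From HB Require Import structures.
From mathcomp Require Import all_boot all_order all_algebra.
From mathcomp Require Import complex.
From mathcomp Require Import all_classical all_reals all_analysis.
Set Implicit Arguments.
Unset Strict Implicit.
Unset Printing Implicit Defensive.
Import Order.TTheory GRing.Theory Num.Theory.
Import numFieldNormedType.Exports.
Local Open Scope classical_set_scope.
Local Open Scope ring_scope.

Section Operators.
Context {R : realType} {H : completeNormedModType R[i]}.
Implicit Types A B : set (H * H).

Definition op_dom A : set H := [set x | exists u, A (x, u)].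

(* [op_mul A B] is the product AB (first B, then A) on its natural domain. *)
Definition op_mul A B : set (H * H) :=
  [set p | exists2 z, B (p.1, z) & A (z, p.2)].

Definition op_fun (f : H -> H) : set (H * H) := [set p | p.2 = f p.1].

(* Graph of a [theta]-semilinear map defined on a linear subspace. *)
Definition semilinear_op (theta : R[i] -> R[i]) A : Prop :=
  [/\ forall x u v, A (x, u) -> A (x, v) -> u = v,
      A (0, 0) &
      forall (a b : R[i]) x y u v, A (x, u) -> A (y, v) ->
        A (a *: x + b *: y, theta a *: u + theta b *: v)].

Definition linear_op A : Prop := semilinear_op id A.
Definition antilinear_op A : Prop := semilinear_op Num.conj A.

Definition densely_defined A : Prop := dense (op_dom A).

Definition conjugation (C : H -> H) : Prop :=
  [/\ forall (a b : R[i]) x y,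
        C (a *: x + b *: y) = Num.conj a *: C x + Num.conj b *: C y,
      forall x, `|C x| = `|x| &
      forall x, C (C x) = x].

Variable dot : {dot H for (@Num.conj R[i])}.

(* <Ax, y> = <x, u> for all x in D(A); a function of y when A is densely
   defined, and similarly for [anti_adj]. *)
Definition op_adj A : set (H * H) :=
  [set p | forall x v, A (x, v) -> dot v p.1 = dot x p.2].

(* <Tx, y> = <u, x> for all x in D(T). *)
Definition anti_adj A : set (H * H) :=
  [set p | forall x v, A (x, v) -> dot v p.1 = dot p.2 x].

Definition linear_normal A : Prop :=
  [/\ linear_op A, densely_defined A, closed A &
      op_mul (op_adj A) A = op_mul A (op_adj A)].

Definition antilinear_normal A : Prop :=
  op_mul (anti_adj A) A = op_mul A (anti_adj A).

Definition positive_selfadjoint A : Prop :=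
  [/\ linear_op A, densely_defined A, op_adj A = A &
      forall x u, A (x, u) -> 0 <= dot u x].

(* The square root of a positive self-adjoint operator A is the (unique)
   positive self-adjoint S with S S = A; set0 is a dummy value. *)
Definition op_sqrt A : set (H * H) :=
  xget set0 [set S | positive_selfadjoint S /\ op_mul S S = A].

Definition op_abs A : set (H * H) := op_sqrt (op_mul (op_adj A) A).
Definition anti_abs A : set (H * H) := op_sqrt (op_mul (anti_adj A) A).

(* Spectral measures on the Borel sets of the real line; the values of E on
   sets that are not Borel are irrelevant. *)
Definition spectral_measure (E : set R -> H -> H) : Prop :=
  [/\ forall M, measurable M ->
        [/\ linear (E M),
            forall x, E M (E M x) = E M x &
            forall x y, dot (E M x) y = dot x (E M y)],
      forall x, E setT x = x &
      forall F : (set R)^nat, (forall n, measurable (F n)) ->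
        trivIset setT F ->
        forall x, (fun n => \sum_(k < n) E (F k) x) @ \oo -->
                  E (\bigcup_n F n) x].

(* The positive finite measure M |-> <E(M)x, x>; the scalar product is real as
   E(M) is an orthogonal projection. *)
Definition diag_measure (E : set R -> H -> H) (x : H) (M : set R) : \bar R :=
  (complex.Re (dot (E M x) x))%:E.

Definition diag_integral (E : set R -> H -> H) (f : R -> R) (x : H) : R :=
  fine (\int[diag_measure E x]_l (f l)%:E)%E.

(* Integral of f against the complex measure M |-> <E(M)x, y>, which by
   polarization is the combination of the measures <E(M)z, z> for
   z = x + i^k y, k < 4. *)
Definition offdiag_integral (E : set R -> H -> H) (f : R -> R) (x y : H) :
    R[i] :=
  4%:R^-1 * \sum_(k < 4) ('i%C : R[i]) ^+ k *
    (real_complex R (diag_integral E f (x + ('i%C : R[i]) ^+ k *: y))).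

Definition spectral_dom (E : set R -> H -> H) (f : R -> R) : set H :=
  [set x | (\int[diag_measure E x]_l ((f l) ^+ 2)%:E < +oo)%E].

(* The operator \int f dE, i.e. the operator A with domain [spectral_dom E f]
   and <Ax, y> = \int f d<E(.)x, y>.  As the domain is a dense linear subspace,
   restricting y to it determines Ax, and it makes all integrals finite. *)
Definition spectral_integral (E : set R -> H -> H) (f : R -> R) : set (H * H) :=
  [set p | spectral_dom E f p.1 /\
    forall y, spectral_dom E f y -> dot p.2 y = offdiag_integral E f p.1 y].

Definition spectral_measure_of A (E : set R -> H -> H) : Prop :=
  spectral_measure E /\ A = spectral_integral E id.

End Operators.

(* Main.v *)
(* If a conjugation C commutes with T^* T = T T^*, then N = TC has the adjoint
   C T^*, so N^* N = C T^* T C = T^* T and N N^* = T T^*: N is normal and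
   |N| = |T|.  It remains to find C commuting with A = |T|, hence with A^2.

   As 1 + A is onto, B = (1 + A)^-1 is an everywhere defined symmetric operator.
   By Zorn's lemma there is a maximal B-invariant set X on which the scalar
   product is real; maximality forces H = X + iX, and C(x + iy) = x - iy is a
   conjugation commuting with B, hence with A.

   For the spectral measure E of A, B commutes with E; it satisfies
   |Bx| >= |x| / (1 + a) on the range of P = E(]-oo, a]) and
   |Bx| <= |x| / (1 + b) on the range of Q = E([b, +oo[).  If a < b, comparing
   B^n P C Q = P C B^n Q for large n gives P C Q = 0.  Letting b tend to a yields
   P C (1 - P) = 0, thus C P C = P, and the half-lines generate the Borel sets. *)
Require Import Defs.
From HB Require Import structures.
From mathcomp Require Import all_boot all_order all_algebra.
From mathcomp Require Import complex.
From mathcomp Require Import all_classical all_reals all_analysis measurable_realfun.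
From mathcomp Require Import ring lra zify.
Set Implicit Arguments.
Unset Strict Implicit.
Unset Printing Implicit Defensive.
Import Order.TTheory GRing.Theory Num.Theory.
Import numFieldNormedType.Exports.
Local Open Scope classical_set_scope.
Local Open Scope ring_scope.

(** * The underlying real inner product space, with real radii *)

Section RealInnerProduct.
Context {R : realType} {H : completeNormedModType R[i]}.
Variable dot : {dot H for (@Num.conj R[i])}.
Hypothesis dot_norm : forall x : H, dot x x = `|x| ^+ 2.
Implicit Types x y z u v : H.

(** Norm and scalar product take values in [R[i]]; passing to real parts lets [lra] and [nra] do the
    estimates. *)
Definition redot x y : R := complex.Re (dot x y).
Definition rnorm x : R := complex.Re `|x|.

Local Notation rd := redot.
Local Notation nr := rnorm.
Local Notation ii := ('i%C : R[i]).

Lemma conjE (a : R[i]) : Num.conj a = conjc a.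
Proof. by []. Qed.

Lemma dotC x y : dot x y = conjc (dot y x).
Proof. by rewrite hermC expr0 mul1r. Qed.

Lemma dotZr (a : R[i]) x y : dot x (a *: y) = conjc a * dot x y.
Proof. by rewrite linearZr_LR. Qed.

Lemma dotZl (a : R[i]) x y : dot (a *: x) y = a * dot x y.
Proof. by rewrite linearZl_LR. Qed.

Lemma redotC x y : rd x y = rd y x.
Proof. by rewrite /redot dotC; case: (dot y x). Qed.

Lemma redotDl x y z : rd (x + y) z = rd x z + rd y z.
Proof. by rewrite /redot linearDl raddfD. Qed.

Lemma redotNl x z : rd (- x) z = - rd x z.
Proof. by rewrite /redot linearNl raddfN. Qed.

Lemma redotBl x y z : rd (x - y) z = rd x z - rd y z.
Proof. by rewrite redotDl redotNl. Qed.

Lemma redot0l z : rd 0 z = 0.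
Proof. by rewrite /redot linear0l. Qed.

Lemma redotZl (a : R) x z : rd (real_complex R a *: x) z = a * rd x z.
Proof.
by rewrite /redot dotZl; case: (dot x z) => b c /=; ring.
Qed.

Lemma redotDr x y z : rd z (x + y) = rd z x + rd z y.
Proof. by rewrite redotC redotDl ![rd _ z]redotC. Qed.

Lemma redotNr x z : rd z (- x) = - rd z x.
Proof. by rewrite redotC redotNl redotC. Qed.

Lemma redotBr x y z : rd z (x - y) = rd z x - rd z y.
Proof. by rewrite redotDr redotNr. Qed.

Lemma redot0r z : rd z 0 = 0.
Proof. by rewrite redotC redot0l. Qed.

Lemma redotZr (a : R) x z : rd z (real_complex R a *: x) = a * rd z x.
Proof. by rewrite redotC redotZl redotC. Qed.

Lemma redotil x y : rd (ii *: x) y = - rd x (ii *: y).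
Proof.
rewrite /redot dotZl dotZr.
by case: (dot x y) => a b /=; ring.
Qed.

Lemma redotii x y : rd (ii *: x) (ii *: y) = rd x y.
Proof.
rewrite /redot dotZl dotZr.
by case: (dot x y) => a b /=; ring.
Qed.

(** Reduces an identity between complex scalar products to two real ones, the second tested against
    [i y]. *)
Lemma dotE x y : dot x y = Complex (rd x y) (rd x (ii *: y)).
Proof.
rewrite /redot dotZr; case: (dot x y) => a b /=.
by congr Complex; ring.
Qed.

Lemma scaleii x : ii *: (ii *: x) = - x.
Proof. by rewrite scalerA -expr2 sqr_i scaleN1r. Qed.

Lemma scale_complex (a : R[i]) x :
  a *: x = real_complex R (complex.Re a) *: x
           + ii *: (real_complex R (complex.Im a) *: x).
Proof. by rewrite {1}(complexE a) scalerDl scalerA. Qed.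

Lemma normE x : `|x| = real_complex R (nr x).
Proof.
have := normr_ge0 x; rewrite /rnorm; case: `|x| => a b.
by rewrite lecE /= => /andP[/eqP-> _].
Qed.

Lemma rnorm_ge0 x : 0 <= nr x.
Proof. by have := normr_ge0 x; rewrite normE ler0c. Qed.

Lemma sqr_rnorm x : nr x ^+ 2 = rd x x.
Proof.
rewrite /redot dot_norm normE.
by rewrite -rmorphXn.
Qed.

Lemma redot_ge0 x : 0 <= rd x x.
Proof. by rewrite -sqr_rnorm sqr_ge0. Qed.

Lemma redot_eq0 x : rd x x = 0 -> x = 0.
Proof.
rewrite -sqr_rnorm => /eqP; rewrite sqrf_eq0 => /eqP nx0.
by apply/eqP; rewrite -normr_eq0 normE nx0.
Qed.

Lemma rnormD x y : nr (x + y) <= nr x + nr y.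
Proof.
by have := ler_normD x y; rewrite !normE -rmorphD lecR.
Qed.

Lemma rnormN x : nr (- x) = nr x.
Proof. by rewrite /rnorm normrN. Qed.

Lemma rnormBC x y : nr (x - y) = nr (y - x).
Proof. by rewrite -rnormN opprB. Qed.

Lemma rnorm_triangle x y z : nr (x - z) <= nr (x - y) + nr (y - z).
Proof. by apply: le_trans (rnormD _ _); rewrite addrA subrK. Qed.

(** Cauchy-Schwarz, by squaring the triangle inequality of the norm. *)
Lemma le_redot x y : rd x y <= nr x * nr y.
Proof.
have := rnormD x y.
rewrite -(ler_pXn2r (_ : (0 < 2)%N)) ?nnegrE ?addr_ge0 ?rnorm_ge0 //.
rewrite sqr_rnorm redotDl !redotDr -!sqr_rnorm (redotC y x); nra.
Qed.

Lemma le_abs_redot x y : `|rd x y| <= nr x * nr y.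
Proof.
rewrite ler_norml le_redot andbT lerNl -redotNl.
by rewrite -[nr x]rnormN le_redot.
Qed.

Lemma redot_eqP x y : (forall z, rd x z = rd y z) -> x = y.
Proof.
move=> xy; apply/subr0_eq/redot_eq0.
by rewrite redotBl xy subrr.
Qed.

Lemma eps_eq0 (r c : R) : (forall e, 0 < e -> `|r| <= c * e) -> r = 0.
Proof.
move=> h; apply/eqP/negPn/negP => r0.
have r0' : 0 < `|r| by rewrite normr_gt0.
have c0 : 0 < c by have := h _ ltr01; lra.
have /h : 0 < `|r| / (2 * c) by apply: divr_gt0 => //; lra.
rewrite (_ : c * _ = `|r| / 2); first lra.
by field; rewrite gt_eqF.
Qed.

Definition nearly (A : set H) x :=
  forall e : R, 0 < e -> exists2 y, A y & nr (x - y) < e.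

Lemma redot_nearly0 (A : set H) u x :
  nearly A x -> (forall y, A y -> rd u y = 0) -> rd u x = 0.
Proof.
move=> xA uA; apply: (@eps_eq0 _ (nr u)) => e /xA[y /uA uy xy].
rewrite -[rd u x]subr0 -uy -redotBr; apply: le_trans (le_abs_redot _ _) _.
by rewrite ler_wpM2l ?rnorm_ge0 // ltW.
Qed.

Lemma ball_rnormE (e : R) x y : ball x (real_complex R e) y = (nr (x - y) < e).
Proof.
by rewrite -ball_normE /ball_ /= normE ltcR.
Qed.

Lemma complex_gt0P (e : R[i]) : 0 < e -> exists2 r : R, 0 < r & e = real_complex R r.
Proof.
case: e => a b; rewrite ltcE /= => /andP[/eqP-> a0]; by exists a.
Qed.

Lemma nearly_closure (A : set H) x : nearly A x -> closure A x.
Proof.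
move=> xA B /nbhs_ballP[_ /= /complex_gt0P[e e0 ->] sB].
by have [y Ay xy] := xA e e0; exists y; split => //; apply: sB; rewrite ball_rnormE.
Qed.

Lemma nearly_dense (A : set H) : dense A -> forall x, nearly A x.
Proof.
move=> dA x e e0.
have [] := dA (ball x (real_complex R e))^°.
- exists x; apply: nbhsx_ballx; by rewrite ltcR.
- exact: open_interior.
- by move=> y [/interior_subset xy Ay]; exists y => //; rewrite -ball_rnormE.
Qed.

Lemma dense_nearly (A : set H) : (forall x, nearly A x) -> dense A.
Proof.
move=> dA O [x Ox] oO.
have /nearly_closure/(_ O) := dA x.
case; first exact: open_nbhs_nbhs.
by move=> y [Ay Oy]; exists y.
Qed.

(** Topological closedness in [H * H], restated with real radii; the next two lemmas give the
    equivalence. *)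
Definition closed_graph (G : set (H * H)) := forall x u,
  (forall e : R, 0 < e ->
     exists y v, [/\ G (y, v), nr (x - y) < e & nr (u - v) < e]) ->
  G (x, u).

Lemma closed_closed_graph (G : set (H * H)) : closed G -> closed_graph G.
Proof.
move=> cG x u xuG; apply: cG => B /nbhs_ballP[_ /= /complex_gt0P[e e0 ->] sB].
have [y [v [Gyv xy uv]]] := xuG e e0.
by exists (y, v); split => //; apply: sB; split; rewrite /= ball_rnormE.
Qed.

Lemma closed_graph_closed (G : set (H * H)) : closed_graph G -> closed G.
Proof.
move=> cG [x u] xuG; apply: cG => e e0.
have /xuG[[y v] [Gyv [/= xy uv]]] :
    nbhs (x, u) (ball (x, u) (real_complex R e)).
  by apply: nbhsx_ballx; rewrite ltcR.
by exists y, v; split => //; rewrite -ball_rnormE.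
Qed.

Lemma rnorm_complete (x : nat -> H) :
  (forall e : R, 0 < e -> exists N, forall n m, (N <= n)%N -> (N <= m)%N ->
     nr (x n - x m) < e) ->
  exists l, forall e : R, 0 < e ->
    exists N, forall n, (N <= n)%N -> nr (x n - l) < e.
Proof.
move=> xC.
have : cauchy (x @ \oo).
  apply/cauchy_ballP => _ /complex_gt0P[e e0 ->].
  have [N hN] := xC e e0.
  rewrite near_simpl; near=> n m => /=; rewrite ball_rnormE; apply: hN.
    by near: n; apply: nbhs_infty_ge.
  by near: m; apply: nbhs_infty_ge.
move=> /cauchy_cvgP/cvg_ex[l /cvg_ballP xl]; exists l => e e0.
have /xl[N _ hN] : (0 : R[i]) < real_complex R e by rewrite ltcR.
by exists N => n /hN; rewrite /= ball_rnormE rnormBC.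
Unshelve. all: by end_near. Qed.

Lemma cvg_rnorm (x : nat -> H) l : x @ \oo --> l ->
  forall e : R, 0 < e -> exists N, forall n, (N <= n)%N -> nr (x n - l) < e.
Proof.
move=> /cvg_ballP xl e e0.
have /xl[N _ hN] : (0 : R[i]) < real_complex R e by rewrite ltcR.
by exists N => n /hN; rewrite /= ball_rnormE rnormBC.
Qed.

End RealInnerProduct.

(** * Orthogonal projection onto closed real subspaces of [H * H] *)

Section Minimization.
Context {R : realType} {H : completeNormedModType R[i]}.
Variable dot : {dot H for (@Num.conj R[i])}.
Hypothesis dot_norm : forall x : H, dot x x = `|x| ^+ 2.
Implicit Types x y z u v h : H.

Local Notation rd := (redot dot).
Local Notation nr := (@rnorm R H).
Local Notation "a %:C" := (real_complex R a).

Lemma eps_le0 (r c : R) : (forall e, 0 < e -> r <= c * e) -> r <= 0.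
Proof.
move=> h; rewrite leNgt; apply/negP => r0.
have c0 : 0 < c by have := h _ ltr01; lra.
have /h : 0 < r / (2 * c) by apply: divr_gt0 => //; lra.
rewrite (_ : c * _ = r / 2); first lra.
by field; rewrite gt_eqF.
Qed.

Lemma natSinv_lt (e : R) : 0 < e ->
  exists N, forall n, (N <= n)%N -> (n.+1%:R)^-1 < e.
Proof.
move=> e0; have [N _ hN] := near_infty_natSinv_lt (PosNum e0).
by exists N => n /hN.
Qed.

(* The orthogonal projection of (h, 0) onto G: minimise |h - x|^2 + |u|^2.  With
   G the graph of T this gives 1 + T^* T onto, with G = X * {0} the projection
   onto X. *)
Lemma real_graph_projection (G : set (H * H)) : closed_graph G -> G (0, 0) ->
  (forall x u y v, G (x, u) -> G (y, v) -> G (x + y, u + v)) ->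
  (forall (a : R) x u, G (x, u) -> G (a%:C *: x, a%:C *: u)) ->
  forall h, exists x u, G (x, u) /\
    forall y v, G (y, v) -> rd (h - x) y = rd u v.
Proof.
move=> cG G0 GD GZ h.
pose f x u := rd (h - x) (h - x) + rd u u.
have f0 x u : 0 <= f x u by rewrite addr_ge0 // redot_ge0.
pose V : set R := [set r | exists x u, G (x, u) /\ r = f x u].
have V0 : V !=set0 by exists (f 0 0), 0, 0.
have lV : has_lbound V by exists 0 => _ [x [u [_ ->]]].
have dle x u : G (x, u) -> inf V <= f x u.
  by move=> Gxu; apply: ge_inf => //; exists x, u.
pose r (n : nat) : R := (n.+1%:R)^-1.
have ex n : exists p : H * H, G p /\ f p.1 p.2 < inf V + r n.
  have [|_ [x [u [Gxu ->]]] lt] := @inf_adherent _ V (r n) _ (conj V0 lV).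
    by rewrite /r invr_gt0 ltr0n.
  by exists (x, u).
have {ex} [p pP] := choice ex.
pose x n := (p n).1; pose u n := (p n).2.
have Gp n : G (x n, u n) by rewrite /x /u -surjective_pairing; have [] := pP n.
have fp n : f (x n) (u n) < inf V + r n by have [] := pP n.
(* Parallelogram law: the midpoint of two terms lies in [G], so [f] is at least [inf V] there. *)
have par n m : rd (x n - x m) (x n - x m) + rd (u n - u m) (u n - u m) <=
    2 * r n + 2 * r m.
  have := dle _ _ (GZ 2^-1 _ _ (GD _ _ _ _ (Gp n) (Gp m))).
  have := fp n; have := fp m; rewrite /f.
  rewrite !(redotBl, redotBr, redotDl, redotDr, redotZl, redotZr).
  rewrite (redotC dot (x m) (x n)) (redotC dot (u m) (u n)).
  rewrite (redotC dot (x m) h) (redotC dot (x n) h).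
  lra.
have small e : 0 < e -> exists N, forall n m, (N <= n)%N -> (N <= m)%N ->
    nr (x n - x m) < e /\ nr (u n - u m) < e.
  move=> e0; have [|N hN] := @natSinv_lt (e ^+ 2 / 4); first by nra.
  exists N => n m /hN; rewrite -/(r n) => en /hN; rewrite -/(r m) => em.
  have := par n m; rewrite -!(sqr_rnorm dot_norm).
  have := rnorm_ge0 (x n - x m); have := rnorm_ge0 (u n - u m).
  by move=> ? ? ?; split; nra.
have [|lx hx] := @rnorm_complete _ _ x.
  by move=> e /small[N hN]; exists N => n m Nn Nm; have [] := hN _ _ Nn Nm.
have [|lu hu] := @rnorm_complete _ _ u.
  by move=> e /small[N hN]; exists N => n m Nn Nm; have [] := hN _ _ Nn Nm.
have lim e : 0 < e -> exists n,
    [/\ nr (x n - lx) < e, nr (u n - lu) < e & r n < e].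
  move=> e0; have [N1 h1] := hx e e0; have [N2 h2] := hu e e0.
  have [N3 h3] := natSinv_lt e0.
  exists (N1 + N2 + N3)%N; split; [apply: h1|apply: h2|apply: h3]; lia.
exists lx, lu; split.
  apply: cG => e /lim[n [? ? _]].
  by exists (x n), (u n); rewrite !(rnormBC lx) !(rnormBC lu).
move=> y v Gyv; apply/eqP; rewrite -subr_eq0; apply/eqP.
set b := _ - _; set g := rd y y + rd v v.
have g0 : 0 <= g by rewrite addr_ge0 // redot_ge0.
(* First variation in the direction [(y, v)], computed at [(x n, u n)]. Replacing these by their
   limits costs [2 * |t| * (nr y + nr v) * e] by Cauchy-Schwarz, and [r n < e] is the defect from
   the infimum. *)
have bt t : 2 * t * b - t ^+ 2 * g <= 0.
  apply: (@eps_le0 _ (2 * `|t| * (nr y + nr v) + 1)) => e /lim[n [xe ue ne]].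
  have := dle _ _ (GD _ _ _ _ (Gp n) (GZ t _ _ Gyv)).
  have := fp n; rewrite /f.
  rewrite !(redotBl, redotBr, redotDl, redotDr, redotZl, redotZr).
  rewrite (redotC dot (x n) h) (redotC dot y h) (redotC dot y (x n)) (redotC dot v (u n)).
  have bx : t * (rd (x n) y - rd lx y) <= `|t| * nr y * e.
    rewrite -redotBl; apply: le_trans (ler_norm _) _.
    rewrite normrM -mulrA ler_wpM2l // mulrC.
    by apply: le_trans (le_abs_redot dot_norm _ _) _; rewrite ler_wpM2r ?rnorm_ge0 ?ltW.
  have bu : t * (rd (u n) v - rd lu v) <= `|t| * nr v * e.
    rewrite -redotBl; apply: le_trans (ler_norm _) _.
    rewrite normrM -mulrA ler_wpM2l // mulrC.
    by apply: le_trans (le_abs_redot dot_norm _ _) _; rewrite ler_wpM2r ?rnorm_ge0 ?ltW.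
  move: bx bu; rewrite /b /g redotBl; lra.
(* The denominator [g + 1] is positive even if [g = 0]; for this [t] the left side is
   [t ^+ 2 * (g + 2)], so [t], hence [b], vanishes. *)
have := bt (b / (g + 1)).
have g1 : g + 1 != 0 by rewrite gt_eqF //; lra.
rewrite (_ : _ - _ = (b / (g + 1)) ^+ 2 * (g + 2)); last by field.
rewrite pmulr_lle0; last lra.
rewrite real_exprn_even_le0 ?num_real //=.
by rewrite mulf_eq0 invr_eq0 (negbTE g1) orbF => /eqP.
Qed.

End Minimization.

(** * Conjugations commuting with a bounded symmetric operator; resolvents *)

Section CommutingConjugation.
Context {R : realType} {H : completeNormedModType R[i]}.
Variable dot : {dot H for (@Num.conj R[i])}.
Hypothesis dot_norm : forall x : H, dot x x = `|x| ^+ 2.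
Implicit Types (x y z u v h : H) (A : set (H * H)).

Local Notation rd := (redot dot).
Local Notation nr := (@rnorm R H).
Local Notation ii := ('i%C : R[i]).
Local Notation "a %:C" := (real_complex R a).

Section ResolventCommutant.
Variable B : H -> H.
Hypothesis BD : forall x y, B (x + y) = B x + B y.
Hypothesis BZ : forall (a : R[i]) x, B (a *: x) = a *: B x.
Hypothesis Bsym : forall x y, rd (B x) y = rd x (B y).

(** By [dotE], [rd x (ii *: y)] is the imaginary part of [dot x y]. *)
Definition real_subset (X : set H) :=
  (forall x y, X x -> X y -> rd x (ii *: y) = 0) /\ (forall x, X x -> X (B x)).

Let iterZ n (a : R[i]) x : iter n B (a *: x) = a *: iter n B x.
Proof. by elim: n => //= n ->; rewrite BZ. Qed.

Let iter_sym n x y : rd (iter n B x) y = rd x (iter n B y).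
Proof. by elim: n x y => //= n IH x y; rewrite Bsym IH -iterS -iterSr. Qed.

(* A maximal B-invariant X on which the scalar product is real contains every z
   whose products with X are real, since the B^n z can then be added to X; in
   particular X is a closed real subspace. *)
Lemma exists_maximal_real : exists X, real_subset X /\
  forall z, (forall x, X x -> rd z (ii *: x) = 0) -> X z.
Proof.
have [F FP Ftot|X [[XX BX] Xmax]] := @Zorn_bigcup H real_subset.
  split=> [x y [X1 F1 X1x] [X2 F2 X2y]|x [X1 F1 X1x]].
    have [X12|X21] := Ftot _ _ F1 F2.
      by have [+ _] := FP _ F2; apply => //; exact: X12.
    by have [+ _] := FP _ F1; apply => //; exact: X21.
  by exists X1 => //; have [_] := FP _ F1; exact.
exists X; split=> // z zX.
pose Y := X `|` [set y | exists n, y = iter n B z].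
(* The product of [B^n z] and [B^m z] is that of [z] and [B^(n+m) z]; powers of [B] being symmetric,
   its imaginary part equals its own opposite. *)
have zz n m : rd (iter n B z) (ii *: iter m B z) = 0.
  rewrite iter_sym iterZ -iterD; set k := (n + m)%N.
  have : rd z (ii *: iter k B z) = - rd z (ii *: iter k B z).
    rewrite -[in RHS]redotil -iter_sym iterZ redotC.
    by rewrite -[in RHS]iterZ; congr (rd _ _); rewrite iterZ.
  lra.
have Xz n x : X x -> rd (iter n B z) (ii *: x) = 0.
  elim: n x => [|n IH] x Xx /=; first exact: zX.
  by rewrite Bsym BZ IH //; exact: BX.
have PY : real_subset Y.
  split=> [x y [Xx|[n ->]] [Xy|[m ->]]|x [Xx|[n ->]]].
  - exact: XX.
  - by rewrite redotC redotil Xz // oppr0.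
  - exact: Xz.
  - exact: zz.
  - by left; exact: BX.
  - by right; exists n.+1.
apply: contrapT => nXz; apply: (Xmax Y _ PY); split; first by move=> x Xx; left.
by move=> YX; apply: nXz; apply: YX; right; exists 0.
Qed.

(** On [H = X + iX] the map sending [x + iy] to [x - iy] is well defined and isometric because the
    norm squared of [x + iy] is that of [x] plus that of [y]; it commutes with [B] because [B]
    preserves [X]. *)
Lemma exists_commuting_conjugation :
  exists C, conjugation C /\ forall x, C (B x) = B (C x).
Proof.
have [X [[XX BX] maxX]] := exists_maximal_real.
have X0 : X 0 by apply: maxX => x _; rewrite redot0l.
have XD x y : X x -> X y -> X (x + y).
  by move=> Xx Xy; apply: maxX => z Xz; rewrite redotDl !XX // addr0.
have XZ (a : R) x : X x -> X (a%:C *: x).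
  by move=> Xx; apply: maxX => z Xz; rewrite redotZl XX // mulr0.
have XN x : X x -> X (- x).
  by move=> Xx; apply: maxX => z Xz; rewrite redotNl XX // oppr0.
(* H = X + iX, as the real orthogonal complement of X is iX *)
have dec h : exists xy : H * H, [/\ X xy.1, X xy.2 & h = xy.1 + ii *: xy.2].
  pose G := [set p : H * H | X p.1 /\ p.2 = 0].
  have cG : closed_graph G.
    move=> x u xu; split => /=.
      apply: maxX => y Xy; rewrite redotC.
      apply: (redot_nearly0 dot_norm (A := X)); last first.
        by move=> z Xz; rewrite redotC XX.
      by move=> e /xu[z [v [[Xz _] xz _]]]; exists z.
    apply: (redot_eq0 dot_norm); rewrite -(sqr_rnorm dot_norm).
    rewrite (@eps_eq0 _ (nr u) 1) ?expr0n // => e /xu[z [v [[_ /= ->] _]]].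
    by rewrite subr0 ger0_norm ?rnorm_ge0 // mul1r => /ltW.
  have GD x u y v : G (x, u) -> G (y, v) -> G (x + y, u + v).
    by move=> [/= Xx ->] [/= Xy ->]; split; rewrite /= ?addr0 //; exact: XD.
  have GZ (a : R) x u : G (x, u) -> G (a%:C *: x, a%:C *: u).
    by move=> [/= Xx ->]; split; rewrite /= ?scaler0 //; exact: XZ.
  have [//|x [u [[/= Xx u0] hx]]] := real_graph_projection dot_norm cG _ GD GZ h.
  (* The second witness is [(h - x) / i]. It lies in [X] by maximality, since its real product with
     [i y] is minus that of [h - x] with [y], which is 0. *)
  exists (x, - (ii *: (h - x))); split => //=; last first.
    by rewrite scalerN scaleii opprK addrC subrK.
  apply: maxX => y Xy; rewrite redotNl redotii (hx y 0) ?redot0r ?oppr0 //.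
have {dec} [pq pqP] := choice dec.
pose p h := (pq h).1; pose q h := (pq h).2.
have Xp h : X (p h) by have [] := pqP h.
have Xq h : X (q h) by have [] := pqP h.
have hpq h : h = p h + ii *: q h by have [] := pqP h.
(* The cross terms are imaginary parts of products of elements of [X]. *)
have sq x y : X x -> X y -> rd (x + ii *: y) (x + ii *: y) = rd x x + rd y y.
  move=> Xx Xy; rewrite redotDl !redotDr redotii redotil !XX //; ring.
have uniq x y x' y' : X x -> X y -> X x' -> X y' ->
    x + ii *: y = x' + ii *: y' -> x = x' /\ y = y'.
  move=> Xx Xy Xx' Xy' E.
  have := sq (x - x') (y - y') (XD _ _ Xx (XN _ Xx')) (XD _ _ Xy (XN _ Xy')).
  rewrite scalerBr addrACA -opprD E subrr redot0l => E0.
  have := redot_ge0 dot_norm (x - x'); have := redot_ge0 dot_norm (y - y').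
  by move=> ? ?; split; apply/subr0_eq/(redot_eq0 dot_norm); lra.
pose C h := p h - ii *: q h.
have CE x y : X x -> X y -> C (x + ii *: y) = x - ii *: y.
  move=> Xx Xy; have [e1 e2] := uniq _ _ _ _ Xx Xy (Xp _) (Xq _) (hpq (x + ii *: y)).
  by rewrite /C -e1 -e2.
have CD h k : C (h + k) = C h + C k.
  rewrite {1}(hpq h) {1}(hpq k) addrACA -scalerDr CE; try exact: XD.
  by rewrite scalerDr opprD addrACA.
have CR (a : R) h : C (a%:C *: h) = a%:C *: C h.
  rewrite {1}(hpq h) scalerDr scalerA mulrC -scalerA CE; try exact: XZ.
  by rewrite /C scalerBr !scalerA mulrC.
have Ci h : C (ii *: h) = - (ii *: C h).
  rewrite {1}(hpq h) scalerDr scaleii addrC CE //; last exact: XN.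
  by rewrite /C scalerBr scaleii opprD opprK addrC.
have CZ (a : R[i]) h : C (a *: h) = conjc a *: C h.
  rewrite (scale_complex a) CD Ci !CR (scale_complex (conjc a)).
  by case: a => a b /=; rewrite rmorphN scaleNr scalerN.
exists C; split.
- split=> [a b x y|x|x].
  + by rewrite CD !CZ.
  + rewrite !normE; congr (real_complex R _).
    apply/eqP; rewrite -(eqrXn2 (_ : (0 < 2)%N) (rnorm_ge0 _) (rnorm_ge0 _)) //.
    rewrite !(sqr_rnorm dot_norm) /C -scalerN sq //; last exact: XN.
    by have := sq _ _ (Xp x) (Xq x); rewrite -hpq redotNl redotNr opprK => ->.
  + rewrite [C x]/C -scalerN CE //; last exact: XN.
    by rewrite scalerN opprK -hpq.
- move=> x; rewrite {1}(hpq x) BD BZ CE; try exact: BX.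
  by rewrite /C BD -[in RHS]scaleNr BZ scaleNr.
Qed.

End ResolventCommutant.

(** Polarization: expand the squared norms of [x + C y] and of its image [C x + y], which agree. *)
Lemma conjugation_redot (C : H -> H) : conjugation C ->
  forall x y, rd (C x) y = rd x (C y).
Proof.
move=> [Cl Cn CC] x y.
have CD h k : C (h + k) = C h + C k.
  by have := Cl 1 1 h k; rewrite conjC1 !scale1r.
have sq h : rd (C h) (C h) = rd h h by rewrite -!(sqr_rnorm dot_norm) /rnorm Cn.
have := sq (x + C y); rewrite CD CC !(redotDl, redotDr) sq.
rewrite (redotC _ y (C x)) (redotC _ (C y) x) -(sq y); lra.
Qed.

(** Real parts agree by [conjugation_redot]; imaginary parts follow from [C (i y) = - i C y]. *)
Lemma conjugation_dot (C : H -> H) : conjugation C ->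
  forall x y, dot (C x) y = dot (C y) x.
Proof.
move=> cC x y; have [Cl _ CC] := cC.
have Ci h : C (ii *: h) = - (ii *: C h).
  have := Cl ii 0 h 0; rewrite scale0r addr0 rmorph0 scale0r addr0 => ->.
  by rewrite conjE -scaleNr; congr (_ *: _); congr Complex; rewrite oppr0.
rewrite !dotE !conjugation_redot // Ci redotNr (redotC _ x (C y)).
congr Complex; rewrite -[in RHS]conjugation_redot //.
by rewrite -redotil redotC.
Qed.

(** [B] is the inverse of [1 + A]: the first two clauses say that it is a right and a left
    inverse. *)
Definition resolvent_of A (B : H -> H) :=
  [/\ forall h, A (B h, h - B h),
      forall x u, A (x, u) -> B (x + u) = x,
      forall x y, B (x + y) = B x + B y,
      forall (a : R[i]) x, B (a *: x) = a *: B x &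
      forall x y, rd (B x) y = rd x (B y)].

Definition symmetric_op A :=
  forall x u y v, A (x, u) -> A (y, v) -> dot u y = dot x v.

Definition positive_op A := forall x u, A (x, u) -> 0 <= dot u x.

Lemma linear_opD A x y u v : linear_op A ->
  A (x, u) -> A (y, v) -> A (x + y, u + v).
Proof.
by move=> [_ _ lA] Ax Ay; have := lA 1 1 _ _ _ _ Ax Ay; rewrite !scale1r.
Qed.

Lemma linear_opZ A (a : R[i]) x u : linear_op A ->
  A (x, u) -> A (a *: x, a *: u).
Proof.
move=> [_ _ lA] Ax; have := lA a 0 _ _ _ _ Ax Ax.
by rewrite !scale0r !addr0.
Qed.

Lemma linear_opB A x y u v : linear_op A ->
  A (x, u) -> A (y, v) -> A (x - y, u - v).
Proof.
move=> lA Ax Ay; have := linear_opZ (-1) lA Ay.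
by rewrite !scaleN1r => /(linear_opD lA Ax).
Qed.

Lemma positive_redot A x u : positive_op A -> A (x, u) -> 0 <= rd u x.
Proof. by move=> pA /pA; rewrite lecE /redot => /andP[]. Qed.

(** Positivity makes [1 + A] injective: [A x = - x] forces [x = 0]. Symmetry of [B] is that of [A]
    between [B x] and [B y], after cancelling the product of [B x] and [B y]. *)
Lemma exists_resolvent A : linear_op A -> symmetric_op A -> positive_op A ->
  (forall h, exists x u, A (x, u) /\ x + u = h) -> exists B, resolvent_of A B.
Proof.
move=> lA sA pA ontoA.
have /choice[B AB] h : exists x, A (x, h - x).
  have [x [u [Axu <-]]] := ontoA h.
  by exists x; rewrite addrC addKr.
have inj x u : A (x, u) -> x + u = 0 -> x = 0.
  move=> Axu /eqP; rewrite addr_eq0 => /eqP xu.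
  have := positive_redot pA Axu; have := redot_ge0 dot_norm u.
  rewrite xu redotNr => u0 u1; rewrite (redot_eq0 (x := u) dot_norm) ?oppr0 //; lra.
have Buniq x u : A (x, u) -> B (x + u) = x.
  move=> Axu; apply/subr0_eq.
  apply: (inj _ _ (linear_opB lA (AB (x + u)) Axu)).
  by rewrite addrACA -opprD (addrC (B _)) subrK subrr.
exists B; split=> //.
- move=> x y; rewrite -[RHS](Buniq _ _ (linear_opD lA (AB x) (AB y))).
  by congr B; rewrite addrACA !(addrC (B _)) !subrK.
- move=> a x; rewrite -[RHS](Buniq _ _ (linear_opZ a lA (AB x))).
  by rewrite -scalerDr addrC subrK.
- move=> x y.
  have := sA _ _ _ _ (AB x) (AB y); rewrite linearBl linearBr => /addIr e.
  by rewrite /redot e.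
Qed.

End CommutingConjugation.

(** * The operator T^* T, positive self-adjoint operators, and commutation with [C] *)

Section OperatorPart.
Context {R : realType} {H : completeNormedModType R[i]}.
Variable dot : {dot H for (@Num.conj R[i])}.
Hypothesis dot_norm : forall x : H, dot x x = `|x| ^+ 2.
Implicit Types (x y z u v h : H) (A S T : set (H * H)).

Local Notation rd := (redot dot).
Local Notation nr := (@rnorm R H).
Local Notation ii := ('i%C : R[i]).
Local Notation "a %:C" := (real_complex R a).

Lemma dense_dot_eq A u v : densely_defined A ->
  (forall x y, A (x, y) -> dot u x = dot v x) -> u = v.
Proof.
move=> dA uv; apply/subr0_eq/(redot_eq0 dot_norm).
apply: (redot_nearly0 dot_norm (nearly_dense dA _)) => x [y /uv e].
by rewrite redotBl /redot e subrr.
Qed.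

(** The two complex conjugations, from [T] and from its adjoint, cancel; density makes the adjoint
    single-valued. *)
Lemma adj_mul_linear T : antilinear_op T -> densely_defined T ->
  linear_op (op_mul (anti_adj dot T) T).
Proof.
move=> [Tf T0 Tl] dT; split.
- move=> x u v [z Txz zu] [z' Txz' zv]; apply: (dense_dot_eq dT) => y w Tyw.
  by rewrite -(zu _ _ Tyw) -(zv _ _ Tyw) (Tf _ _ _ Txz Txz').
- by exists 0 => // x v _; rewrite linear0l linear0r.
- move=> a b x y u v [z Txz zu] [w Tyw wv].
  exists (Num.conj a *: z + Num.conj b *: w); first exact: Tl.
  move=> s t Tst /=; rewrite linearDr linearDl /= !dotZr !dotZl /=.
  by rewrite (zu _ _ Tst) (wv _ _ Tst) !conjcK.
Qed.

Lemma adj_mul_symmetric T : symmetric_op dot (op_mul (anti_adj dot T) T).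
Proof.
move=> x u y v [z Txz zu] [w Tyw wv].
by rewrite -(zu _ _ Tyw) (dotC dot x v) -(wv _ _ Txz) -dotC.
Qed.

Lemma adj_mul_positive T : positive_op dot (op_mul (anti_adj dot T) T).
Proof. by move=> x u [z Txz zu]; rewrite -(zu _ _ Txz) dnorm_ge0. Qed.

(** If [(x, u)] is the projection of [(h, 0)] onto the graph of [T], orthogonality says that [h - x]
    is the adjoint of [T] applied to [u]. Testing against [(y, v)] gives real parts, against
    [(i y, - i v)] imaginary parts. *)
Lemma adj_mul_onto T : antilinear_op T -> closed T ->
  forall h, exists x u, op_mul (anti_adj dot T) T (x, u) /\ x + u = h.
Proof.
move=> [_ T0 Tl] cT h.
have TD x u y v : T (x, u) -> T (y, v) -> T (x + y, u + v).
  by move=> Tx Ty; have := Tl 1 1 _ _ _ _ Tx Ty; rewrite !rmorph1 !scale1r.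
have TZ (a : R[i]) x u : T (x, u) -> T (a *: x, Num.conj a *: u).
  move=> Tx; have := Tl a 0 _ _ _ _ Tx Tx.
  by rewrite rmorph0 !scale0r !addr0.
have TR (a : R) x u : T (x, u) -> T (a%:C *: x, a%:C *: u).
  by move=> /(TZ (a%:C)); rewrite conjE conjc_real.
have [x [u [Txu ort]]] := real_graph_projection dot_norm (closed_closed_graph cT) T0 TD TR h.
exists x, (h - x); split; last by rewrite addrC subrK.
exists u => // y v Tyv /=; rewrite !dotE; congr Complex.
  by rewrite redotC (ort _ _ Tyv).
rewrite (ort _ _ (TZ ii _ _ Tyv)).
have -> : Num.conj ii = - ii by rewrite conjE; congr Complex; rewrite oppr0.
by rewrite scaleNr redotNr -redotil redotC.
Qed.

Lemma selfadjoint_symmetric S : op_adj dot S = S -> symmetric_op dot S.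
Proof. by move=> sS x u y v Sxu; rewrite -{1}sS; exact. Qed.

(** The real identity applied to [i y] supplies the imaginary part. *)
Lemma op_adj_redot S x u : linear_op S ->
  (forall y v, S (y, v) -> rd v x = rd y u) -> op_adj dot S (x, u).
Proof.
move=> lS xu y v Syv /=; rewrite !dotE (xu _ _ Syv); congr Complex.
have := xu _ _ (linear_opZ ii lS Syv).
by rewrite !redotil => /oppr_inj.
Qed.

(** The identity defining the adjoint is stable under limits in [x] and [u]. *)
Lemma selfadjoint_closed S : linear_op S -> op_adj dot S = S -> closed_graph S.
Proof.
move=> lS sS x u xu; rewrite -sS; apply: op_adj_redot => // y v Syv.
apply/eqP; rewrite -subr_eq0; apply/eqP.
apply: (@eps_eq0 _ _ (nr v + nr y)) => e /xu[z [w [Szw xz uw]]].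
have : rd v z = rd y w.
  by rewrite /redot (selfadjoint_symmetric sS Syv Szw).
move=> vz; rewrite (_ : _ - _ = rd v (x - z) - rd y (u - w)); last first.
  by rewrite !redotBr vz; ring.
apply: le_trans (ler_normB _ _) _; rewrite mulrDl; apply: lerD.
  apply: le_trans (le_abs_redot dot_norm _ _) _.
  by rewrite ler_wpM2l ?rnorm_ge0 ?ltW.
apply: le_trans (le_abs_redot dot_norm _ _) _.
by rewrite ler_wpM2l ?rnorm_ge0 ?ltW.
Qed.

Lemma positive_contraction S x u : positive_op dot S -> S (x, u) ->
  nr x <= nr (x + u) /\ nr u <= nr (x + u).
Proof.
move=> pS Sxu; have := positive_redot pS Sxu => ux.
by split; rewrite -(ler_pXn2r (_ : (0 < 2)%N)) ?nnegrE ?rnorm_ge0 //;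
  rewrite !(sqr_rnorm dot_norm) !(redotDl, redotDr) (redotC _ x u);
  have := redot_ge0 dot_norm x; have := redot_ge0 dot_norm u; lra.
Qed.

(** By [positive_contraction], if the sums [x n + u n] form a Cauchy sequence, so do [x n] and [u n]
    separately, and the limit pair stays in the closed graph. *)
Lemma positive_range_closed S h : linear_op S -> positive_op dot S ->
  closed_graph S ->
  (forall e : R, 0 < e -> exists x u, S (x, u) /\ nr (h - (x + u)) < e) ->
  exists x u, S (x, u) /\ x + u = h.
Proof.
move=> lS pS cS hS.
have ex n : exists p : H * H, S p /\ nr (h - (p.1 + p.2)) < (n.+1%:R)^-1.
  have [|x [u xu]] := hS (n.+1%:R)^-1; first by rewrite invr_gt0 ltr0n.
  by exists (x, u).
have {ex} [p pP] := choice ex.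
pose x n := (p n).1; pose u n := (p n).2.
have Sp n : S (x n, u n) by rewrite /x /u -surjective_pairing; have [] := pP n.
have hp n : nr (h - (x n + u n)) < (n.+1%:R)^-1 by have [] := pP n.
have small e : 0 < e -> exists N, forall n m, (N <= n)%N -> (N <= m)%N ->
    nr (x n - x m) < e /\ nr (u n - u m) < e.
  move=> e0; have [|N hN] := @natSinv_lt R (e / 2); first by lra.
  exists N => n m /hN en /hN em.
  have [] := positive_contraction pS (linear_opB lS (Sp n) (Sp m)).
  have := rnorm_triangle (x n + u n) h (x m + u m).
  rewrite (rnormBC _ h) addrACA -opprD.
  have := hp n; have := hp m; set a := _^-1 in em *; set b := _^-1 in en *.
  by move=> ? ? ? ? ?; split; lra.
have [|lx hx] := @rnorm_complete _ _ x.
  by move=> e /small[N hN]; exists N => n m Nn Nm; have [] := hN _ _ Nn Nm.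
have [|lu hu] := @rnorm_complete _ _ u.
  by move=> e /small[N hN]; exists N => n m Nn Nm; have [] := hN _ _ Nn Nm.
have lim e : 0 < e -> exists n,
    [/\ nr (x n - lx) < e, nr (u n - lu) < e & (n.+1%:R)^-1 < e].
  move=> e0; have [N1 h1] := hx e e0; have [N2 h2] := hu e e0.
  have [N3 h3] := natSinv_lt e0.
  exists (N1 + N2 + N3)%N; split; [apply: h1|apply: h2|apply: h3]; lia.
exists lx, lu; split.
  apply: cS => e /lim[n [? ? _]].
  by exists (x n), (u n); rewrite !(rnormBC lx) !(rnormBC lu).
apply/esym/subr0_eq/(redot_eq0 dot_norm); rewrite -(sqr_rnorm dot_norm).
rewrite (@eps_eq0 _ (nr (h - (lx + lu))) 3) ?expr0n // => e /lim[n [xe ue ne]].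
rewrite ger0_norm ?rnorm_ge0 //.
have := rnorm_triangle h (x n + u n) (lx + lu).
have := rnormD (x n - lx) (u n - lu); rewrite addrACA -opprD.
have := hp n; set a := _^-1 in ne *; lra.
Qed.

(** Project [h] onto the closed range of [1 + S], getting [k]. As [h - k] is orthogonal to this
    range, it lies in the domain of the adjoint, which is [S], and [S] maps it to its opposite;
    positivity gives [h = k]. *)
Lemma selfadjoint_onto S : positive_selfadjoint dot S ->
  forall h, exists x u, S (x, u) /\ x + u = h.
Proof.
move=> [lS dS sS pS] h.
have cS := selfadjoint_closed lS sS.
pose G := [set p : H * H | (exists x u, S (x, u) /\ x + u = p.1) /\ p.2 = 0].
have S0 : S (0, 0) by case: lS.
have cG : closed_graph G.
  move=> x u xu; split => /=.
    apply: positive_range_closed => // e /xu[y [v [[/= [z [w [Szw <-]]] _] xy _]]].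
    by exists z, w.
  apply: (redot_eq0 dot_norm); rewrite -(sqr_rnorm dot_norm).
  rewrite (@eps_eq0 _ (nr u) 1) ?expr0n // => e /xu[z [v [[_ /= ->] _]]].
  by rewrite subr0 ger0_norm ?rnorm_ge0 // mul1r => /ltW.
have G0 : G (0, 0) by split => //=; exists 0, 0; rewrite addr0.
have GD x u y v : G (x, u) -> G (y, v) -> G (x + y, u + v).
  move=> [/= [x1 [x2 [Sx <-]]] ->] [/= [y1 [y2 [Sy <-]]] ->].
  split; rewrite /= ?addr0 //; exists (x1 + y1), (x2 + y2).
  by split; [exact: linear_opD|rewrite addrACA].
have GZ (a : R) x u : G (x, u) -> G (a%:C *: x, a%:C *: u).
  move=> [/= [x1 [x2 [Sx <-]]] ->]; split; rewrite /= ?scaler0 //.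
  exists (a%:C *: x1), (a%:C *: x2).
  by split; [exact: linear_opZ|rewrite scalerDr].
have [k [z [[/= kS z0] ort]]] := real_graph_projection dot_norm cG G0 GD GZ h.
suff /eqP : h - k = 0 by rewrite subr_eq0 => /eqP ->.
have gS : S (h - k, - (h - k)).
  rewrite -sS; apply: op_adj_redot => // y v Syv.
  have := ort (y + v) 0; rewrite redot0r redotDr redotNr => e.
  rewrite (redotC _ v) (redotC _ y); have : G (y + v, 0).
    by split => //=; exists y, v.
  move=> /e; lra.
have := positive_redot pS gS; rewrite redotNl => g0.
apply: (redot_eq0 dot_norm); have := redot_ge0 dot_norm (h - k); lra.
Qed.

(** An inclusion of graphs only; for a conjugation it yields the equality [C A C = A], domains
    included, since [C] is an involution. *)
Definition commutes_with (C : H -> H) A :=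
  forall x u, A (x, u) -> A (C x, C u).

(** [B (C x + C u) = C (B (x + u)) = C x], so [C x] is in the domain of [A] with value [C u]. *)
Lemma commutes_resolvent (C B : H -> H) A : conjugation C ->
  resolvent_of dot A B -> (forall x, C (B x) = B (C x)) -> commutes_with C A.
Proof.
move=> [Cl _ _] [AB Buniq _ _ _] CB x u Axu.
have e : B (C x + C u) = C x.
  have := Cl 1 1 x u; rewrite conjC1 !scale1r => <-.
  by rewrite -CB (Buniq _ _ Axu).
by have := AB (C x + C u); rewrite e addrAC subrr add0r.
Qed.

Lemma exists_conjugation_commuting A : linear_op A -> symmetric_op dot A ->
  positive_op dot A -> (forall h, exists x u, A (x, u) /\ x + u = h) ->
  exists C, conjugation C /\ commutes_with C A.
Proof.
move=> lA sA pA oA; have [B AB] := exists_resolvent dot_norm lA sA pA oA.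
have [_ _ BD BZ Bs] := AB.
have [C [cC CB]] := exists_commuting_conjugation dot_norm BD BZ Bs.
by exists C; split => //; exact: commutes_resolvent AB CB.
Qed.

Lemma commutes_mul (C : H -> H) A A' : commutes_with C A -> commutes_with C A' ->
  commutes_with C (op_mul A A').
Proof. by move=> cA cA' x u [z ? ?]; exists (C z); [exact: cA'|exact: cA]. Qed.

Lemma commutes_conj_mul (C : H -> H) A : conjugation C -> commutes_with C A ->
  op_mul (op_fun C) (op_mul A (op_fun C)) = A.
Proof.
move=> [_ _ CC] CA; apply/seteqP; split=> [[x u]|[x u] Axu].
  move=> [z [w]]; rewrite /op_fun /= => -> /CA Aw ->.
  by rewrite -(CC x).
exists (C u); last by rewrite /op_fun /= CC.
by exists (C x); [|exact: CA].
Qed.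

(** * The linear operator [N], obtained from [T] by composing with [C] *)

Section NormalPart.
Variables (T : set (H * H)) (C : H -> H).
Hypotheses (cC : conjugation C) (aT : antilinear_op T).
Let N := op_mul T (op_fun C).

Let CC x : C (C x) = x. Proof. by case: cC. Qed.

Let NE x u : N (x, u) <-> T (C x, u).
Proof. by split=> [[z]|]; [rewrite /op_fun /= => ->|exists (C x)]. Qed.

Lemma conj_mulK : T = op_mul N (op_fun C).
Proof.
apply/seteqP; split=> [[x u] Txu|[x u] [z]]; last first.
  by rewrite /op_fun /= => -> /NE; rewrite CC.
by exists (C x) => //; apply/NE; rewrite CC.
Qed.

(** The adjoint of [N] is [C] after that of [T], because [conjugation_dot] moves [C] across the
    scalar product. *)
Lemma adj_conj_mul y w : op_adj dot N (y, w) <-> anti_adj dot T (y, C w).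
Proof.
split=> yw x v.
  by rewrite -{1}(CC x) => /NE/yw /= ->; rewrite conjugation_dot.
by move=> /NE/yw /= ->; rewrite conjugation_dot // CC.
Qed.

Lemma conj_mul_linear : linear_op N.
Proof.
have [Cl _ _] := cC; have [Tf T0 Tl] := aT; split.
- by move=> x u v /NE xu /NE; exact: Tf.
- have C0 : C 0 = 0 by have := Cl 0 0 0 0; rewrite !scale0r addr0 rmorph0 !scale0r addr0.
  by apply/NE; rewrite C0.
- move=> a b x y u v /NE xu /NE yv; apply/NE; rewrite Cl.
  by have := Tl (Num.conj a) (Num.conj b) _ _ _ _ xu yv; rewrite !conjCK.
Qed.

Lemma conjugationB x y : C (x - y) = C x - C y.
Proof.
have [Cl _ _] := cC; have := Cl 1 (-1) x y.
by rewrite rmorphN /= !conjC1 !scaleN1r !scale1r.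
Qed.

Lemma rnorm_conjugation x : nr (C x) = nr x.
Proof. by have [_ Cn _] := cC; rewrite /rnorm Cn. Qed.

Lemma conj_mul_dense : densely_defined T -> densely_defined N.
Proof.
move=> dT; apply: dense_nearly => x e e0.
have [y [u Tyu] xy] := nearly_dense dT (C x) e0.
exists (C y); first by exists u; apply/NE; rewrite CC.
by rewrite -rnorm_conjugation conjugationB CC.
Qed.

Lemma conj_mul_closed : closed T -> closed N.
Proof.
move=> /closed_closed_graph cT; apply: closed_graph_closed => x u xu.
apply/NE; apply: cT => e /xu[y [v [/NE Nyv xy uv]]].
by exists (C y), v; split => //; rewrite -conjugationB rnorm_conjugation.
Qed.

Lemma adj_mul_conj_mul : commutes_with C (op_mul (anti_adj dot T) T) ->
  op_mul (op_adj dot N) N = op_mul (anti_adj dot T) T.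
Proof.
move=> cA; apply/seteqP; split=> [[x w]|[x w] /cA].
  move=> [z /NE xz /adj_conj_mul zw]; rewrite -(CC x) -(CC w); apply: cA.
  by exists z.
by move=> [z xz zw]; exists z; [exact/NE|exact/adj_conj_mul].
Qed.

(** The two factors [C] meet in the middle and cancel. *)
Lemma conj_mul_mul_adj : op_mul N (op_adj dot N) = op_mul T (anti_adj dot T).
Proof.
apply/seteqP; split=> [[x w] [z /adj_conj_mul xz /NE zw]|[x w] [z xz zw]].
  by exists (C z).
by exists (C z); [apply/adj_conj_mul|apply/NE]; rewrite /= CC.
Qed.

Lemma conj_mul_normal : densely_defined T -> closed T ->
  antilinear_normal dot T -> commutes_with C (op_mul (anti_adj dot T) T) ->
  linear_normal dot N.
Proof.
move=> dT cT nT cA; split.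
- exact: conj_mul_linear.
- exact: conj_mul_dense.
- exact: conj_mul_closed.
- by rewrite adj_mul_conj_mul // conj_mul_mul_adj.
Qed.

End NormalPart.

End OperatorPart.

(** * Spectral measures: projections, diagonal measures, and the integral of the identity *)

Section SpectralMeasures.
Context {R : realType} {H : completeNormedModType R[i]}.
Variable dot : {dot H for (@Num.conj R[i])}.
Hypothesis dot_norm : forall x : H, dot x x = `|x| ^+ 2.
Implicit Types (x y z u v h : H) (M L : set R) (A S T : set (H * H)).

Local Notation rd := (redot dot).
Local Notation nr := (@rnorm R H).
Local Notation ii := ('i%C : R[i]).
Local Notation "a %:C" := (real_complex R a).

Variable E : set R -> H -> H.
Hypothesis hE : spectral_measure dot E.

Lemma spectral_projD M x y : measurable M -> E M (x + y) = E M x + E M y.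
Proof.
by move=> mM; have [/(_ _ mM)[lE _ _] _ _] := hE; have := lE 1 x y; rewrite !scale1r.
Qed.

Lemma spectral_proj0 M : measurable M -> E M 0 = 0.
Proof.
move=> mM; have := spectral_projD 0 0 mM; rewrite addr0 => /esym/eqP.
by rewrite -subr_eq0 addrK => /eqP.
Qed.

Lemma spectral_projZ M (a : R[i]) x : measurable M -> E M (a *: x) = a *: E M x.
Proof.
move=> mM; have [/(_ _ mM)[lE _ _] _ _] := hE.
by have := lE a x 0; rewrite spectral_proj0 // !addr0.
Qed.

Lemma spectral_projN M x : measurable M -> E M (- x) = - E M x.
Proof. by move=> mM; rewrite -scaleN1r spectral_projZ // scaleN1r. Qed.

Lemma spectral_projB M x y : measurable M -> E M (x - y) = E M x - E M y.
Proof. by move=> mM; rewrite spectral_projD // spectral_projN. Qed.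

Lemma spectral_projK M x : measurable M -> E M (E M x) = E M x.
Proof. by move=> mM; have [/(_ _ mM)[_ + _] _ _] := hE; exact. Qed.

Lemma spectral_proj_dot M x y : measurable M -> dot (E M x) y = dot x (E M y).
Proof. by move=> mM; have [/(_ _ mM)[_ _ +] _ _] := hE; exact. Qed.

Lemma spectral_proj_redot M x y : measurable M -> rd (E M x) y = rd x (E M y).
Proof. by move=> mM; rewrite /redot spectral_proj_dot. Qed.

Lemma spectral_proj_sqr M x : measurable M -> rd (E M x) x = nr (E M x) ^+ 2.
Proof. by move=> mM; rewrite (sqr_rnorm dot_norm) -spectral_proj_redot // spectral_projK. Qed.

Lemma spectral_projT x : E setT x = x.
Proof. by have [_ ET _] := hE. Qed.

Lemma spectral_proj_cvg (F : (set R)^nat) x : (forall n, measurable (F n)) ->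
  trivIset setT F -> forall e : R, 0 < e ->
  exists N, forall n, (N <= n)%N ->
    nr (\sum_(k < n) E (F k) x - E (\bigcup_n F n) x) < e.
Proof.
by move=> mF tF; have [_ _ /(_ F mF tF x)] := hE; exact: cvg_rnorm.
Qed.

(** For the constant sequence of empty sets, consecutive partial sums differ by [E set0 x] and
    converge. *)
Lemma spectral_proj_set0 x : E set0 x = 0.
Proof.
have tF : trivIset [set: nat] (fun=> @set0 R) by exact: trivIset_set0.
apply: (redot_eq0 dot_norm); rewrite -(sqr_rnorm dot_norm).
rewrite (@eps_eq0 _ (nr (E set0 x)) 2) ?expr0n // => e e0.
have [N hN] := @spectral_proj_cvg (fun=> set0) x (fun=> measurable0) tF e e0.
have := hN _ (leqnSn N); have := hN _ (leqnn N); rewrite big_ord_recr /=.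
set s := \sum_(_ < _) _; set b := E (\bigcup__ _) x => n1 n2.
have := rnorm_triangle (s + E set0 x) b s.
by rewrite (rnormBC b) addrAC subrr add0r ger0_norm ?rnorm_ge0 //; lra.
Qed.

Lemma spectral_proj_setU L M x : measurable L -> measurable M -> L `&` M = set0 ->
  E (L `|` M) x = E L x + E M x.
Proof.
move=> mL mM LM.
have mF n : measurable (bigcup2 L M n) by case: n => [|[|n]] //=.
have tF : trivIset setT (bigcup2 L M).
  apply/trivIsetP => -[|[|i]] [|[|j]] _ _ //= _; rewrite ?set0I ?setI0 //.
  by rewrite setIC.
apply/subr0_eq/(redot_eq0 dot_norm); rewrite -(sqr_rnorm dot_norm) -bigcup2E.
rewrite (@eps_eq0 _ (nr _) 1) ?expr0n // => e e0.
have [N hN] := spectral_proj_cvg x mF tF e0.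
rewrite ger0_norm ?rnorm_ge0 // mul1r rnormBC.
(* An index of at least 2, so that the partial sum contains both [L] and [M]; later terms are
   empty. *)
have := hN N.+2 (leq_trans (leqnSn _) (leqnSn _)).
rewrite !big_ord_recl /= big1 => [|i _]; last exact: spectral_proj_set0.
by rewrite addr0 => /ltW.
Qed.

Lemma spectral_projC M x : measurable M -> E (~` M) x = x - E M x.
Proof.
move=> mM; have := spectral_proj_setU x mM (measurableC mM) (setICr _).
by rewrite setUv spectral_projT => {2}->; rewrite addrAC subrr add0r.
Qed.

(** The sum of the two projections is a projection, so they anticommute. Multiplying by [E L] on
    either side shows that they also commute, so their product is 0. *)
Lemma spectral_proj_disjoint L M x : measurable L -> measurable M -> L `&` M = set0 ->
  E L (E M x) = 0.
Proof.
move=> mL mM LM.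
have anti y : E L (E M y) + E M (E L y) = 0.
  have := spectral_projK y (measurableU _ _ mL mM).
  rewrite !spectral_proj_setU // !spectral_projD // !spectral_projK // => e.
  apply: (addrI (E L y + E M y)); rewrite addr0 -[RHS]e addrACA.
  by congr (_ + _); exact: addrC.
have c y : E L (E M y) = E M (E L y).
  have := anti (E L y); have := congr1 (E L) (anti y).
  rewrite spectral_projD // !spectral_projK // spectral_proj0 // => e1 e2.
  apply: (addIr (E L (E M (E L y)))); rewrite e1 addrC e2 //.
have := anti x; rewrite -c => /eqP; rewrite -mulr2n -scaler_nat scaler_eq0.
by rewrite pnatr_eq0 /= => /eqP.
Qed.

Lemma spectral_proj_setI L M x : measurable L -> measurable M ->
  E L (E M x) = E (L `&` M) x.
Proof.
move=> mL mM; have mLM := measurableI _ _ mL mM.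
have d1 : (L `&` M) `&` (L `&` ~` M) = set0.
  by rewrite setIACA setICr setI0.
have d2 : (L `&` M) `&` (~` L `&` M) = set0.
  by rewrite setIACA setICr set0I.
have mL' := measurableI _ _ mL (measurableC mM).
have mM' := measurableI _ _ (measurableC mL) mM.
have EL y : E L y = E (L `&` M) y + E (L `&` ~` M) y.
  by rewrite -spectral_proj_setU // -setIUr setUv setIT.
have EM y : E M y = E (L `&` M) y + E (~` L `&` M) y.
  by rewrite -spectral_proj_setU // -setIUl setUv setTI.
rewrite EM spectral_projD // [E L (E (_ `&` M) x)]EL spectral_projK //.
rewrite !(spectral_proj_disjoint x) ?addr0 //.
- by rewrite setIA setICr set0I.
- by rewrite setIC.
Qed.

(* A version of [diag_measure] that is nonnegative on non-measurable sets too, as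
   the type of measures requires. *)
Definition spectral_weight x M : \bar R := (nr (E M x) ^+ 2)%:E.

Lemma spectral_weightE x M : measurable M ->
  spectral_weight x M = (rd (E M x) x)%:E.
Proof. by move=> mM; rewrite /spectral_weight spectral_proj_sqr. Qed.

Let spectral_weight0 x : spectral_weight x set0 = 0%E.
Proof. by rewrite spectral_weightE // spectral_proj_set0 redot0l. Qed.

Let spectral_weight_ge0 x M : (0 <= spectral_weight x M)%E.
Proof. by rewrite lee_fin sqr_ge0. Qed.

Let spectral_weight_sigma_additive x : semi_sigma_additive (spectral_weight x).
Proof.
move=> F mF tF mUF; rewrite spectral_weightE //.
rewrite (_ : (fun n => _) = EFin \o (fun n => rd (\sum_(k < n) E (F k) x) x)).
  apply: cvg_EFin; first by near=> n.
  apply/cvgrPdist_lt => e e0; have n0 := rnorm_ge0 x.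
  have d0 : 0 < e / (nr x + 1) by rewrite divr_gt0 // ltr_wpDl.
  near=> n.
  rewrite distrC -redotBl.
  apply: le_lt_trans (le_abs_redot dot_norm _ _) _.
  have : nr (\sum_(k < n) E (F k) x - E (\bigcup_n F n) x) < e / (nr x + 1).
    near: n.
    have [N hN] := spectral_proj_cvg x mF tF d0.
    by exists N.
  rewrite ltr_pdivlMr; last lra.
  set s := nr (_ - _); have s0 : 0 <= s by exact: rnorm_ge0.
  by rewrite mulrDr mulr1; lra.
apply/funext => n; rewrite big_mkord /=.
under eq_bigr do rewrite spectral_weightE //.
elim: n => [|n IH]; first by rewrite !big_ord0 redot0l.
by rewrite !big_ord_recr /= redotDl EFinD IH.
Unshelve. all: by end_near. Qed.

HB.instance Definition _ x := isMeasure.Build _ _ _ (spectral_weight x)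
  (spectral_weight0 x) (@spectral_weight_ge0 x)
  (@spectral_weight_sigma_additive x).


Import HBNNSimple.

(** Both set functions agree on measurable sets, hence on the level sets of simple functions; this
    makes measure theory available for [diag_measure]. *)
Lemma diag_measure_integral (f : R -> \bar R) x :
  (\int[diag_measure dot E x]_l f l = \int[spectral_weight x]_l f l)%E.
Proof.
have sE (h : {nnsfun R >-> R}) :
    sintegral (diag_measure dot E x) h = sintegral (spectral_weight x) h.
  by apply: eq_fsbigr => r _; rewrite spectral_weightE.
rewrite /integral.
by congr (ereal_sup _ - ereal_sup _)%E; apply/seteqP; split=> _ [h hf <-];
  exists h => //; rewrite sE.
Qed.

Local Notation dom := (spectral_dom dot E id).
Local Notation q := (diag_integral dot E id).

(** The diagonal measure of [x] is the sum of those of [y] and [z]; domains and diagonal integrals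
    then split accordingly. *)
Definition weight_sum x y z := forall M, measurable M ->
  rd (E M x) x = rd (E M y) y + rd (E M z) z.

Let msqr : measurable_fun [set: R] (fun l : R => (l ^+ 2)%:E).
Proof. by apply/measurable_EFinP; exact: measurable_funX. Qed.

Lemma weight_sumE x y z : weight_sum x y z ->
  forall f : R -> \bar R, (\int[spectral_weight x]_l f l =
    \int[measure_add (spectral_weight y) (spectral_weight z)]_l f l)%E.
Proof.
move=> xyz f; apply: eq_measure_integral => M mM _.
rewrite /= /msum 2!big_ord_recl /= big_ord0 adde0 !spectral_weightE //.
by rewrite xyz.
Qed.

Lemma weight_sum_sqr x y z : weight_sum x y z ->
  (\int[spectral_weight x]_l (l ^+ 2)%:E =
   \int[spectral_weight y]_l (l ^+ 2)%:E +
   \int[spectral_weight z]_l (l ^+ 2)%:E)%E.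
Proof.
move=> /weight_sumE ->; apply: ge0_integral_measure_add => //.
by move=> l _; rewrite lee_fin sqr_ge0.
Qed.

Lemma spectral_domE x : dom x <-> (\int[spectral_weight x]_l (l ^+ 2)%:E < +oo)%E.
Proof. by rewrite -diag_measure_integral. Qed.

Lemma weight_sum_dom x y z : weight_sum x y z -> dom x <-> dom y /\ dom z.
Proof.
move=> /weight_sum_sqr e; rewrite !spectral_domE e.
have := @integral_ge0 _ _ _ (spectral_weight y) setT (fun l => (l ^+ 2)%:E)
  (fun l _ => sqr_ge0 l).
have := @integral_ge0 _ _ _ (spectral_weight z) setT (fun l => (l ^+ 2)%:E)
  (fun l _ => sqr_ge0 l).
case: integral => [s| |] //; case: integral => [t| |] //= _ _;
  rewrite ?ltry; by split=> // -[].
Qed.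

(** The measure is finite and [|l| <= 1 + l ^+ 2]. *)
Lemma spectral_weight_integrable x : dom x ->
  (spectral_weight x).-integrable setT (fun l : R => l%:E).
Proof.
move=> /spectral_domE dx.
have i1 : (spectral_weight x).-integrable setT (fun l : R => 1%:E).
  apply/integrableP; split => //.
  under eq_integral do rewrite abse1.
  by rewrite integral_cst // mul1e ltry.
have i2 : (spectral_weight x).-integrable setT (fun l : R => (l ^+ 2)%:E).
  apply/integrableP; split => //.
  by under eq_integral do rewrite gee0_abs ?lee_fin ?sqr_ge0 //.
apply: le_integrable (integrableD measurableT i1 i2) => //.
  exact: EFin_measurable.
move=> l _ /=; have l0 : 0 <= 1 + l ^+ 2 by rewrite addr_ge0 ?sqr_ge0.
rewrite lee_fin (ger0_norm l0) ler_norml; apply/andP; split; nra.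
Qed.

Lemma diag_integralE x : q x = fine (\int[spectral_weight x]_l l%:E).
Proof. by rewrite /diag_integral diag_measure_integral. Qed.

Lemma weight_sum_diag x y z : weight_sum x y z -> dom x -> q x = q y + q z.
Proof.
move=> xyz dx; have [dy dz] := (weight_sum_dom xyz).1 dx.
have iy := spectral_weight_integrable dy; have iz := spectral_weight_integrable dz.
rewrite !diag_integralE (weight_sumE xyz).
rewrite integral_measure_add // fineD //; exact: integrable_fin_num.
Qed.

(** A vector in the range of [E M] has a diagonal measure concentrated on [M]. *)
Lemma diag_integral_restrict x M : measurable M -> dom x -> E M x = x ->
  [/\ (spectral_weight x).-integrable M (fun l : R => l%:E),
      forall c : R, (spectral_weight x).-integrable M (cst c%:E),
      forall c : R, (\int[spectral_weight x]_(l in M) cst c%:E l =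
                     (c * rd x x)%:E)%E &
      (q x)%:E = (\int[spectral_weight x]_(l in M) l%:E)%E].
Proof.
move=> mM dx Mx; have ix := spectral_weight_integrable dx.
have iM : (spectral_weight x).-integrable M (fun l : R => l%:E).
  exact: integrableS ix.
have wM : spectral_weight x M = (rd x x)%:E by rewrite spectral_weightE // Mx.
split=> // [c|c|].
- apply/integrableP; split => //.
  by rewrite (integral_cst _ mM `|c%:E|) /= wM -EFinM ltry.
- by rewrite integral_cst //= wM -EFinM.
rewrite diag_integralE (negligible_integral (measurableC mM)) //; last first.
  rewrite /= spectral_weightE; last exact: measurableC.
  by rewrite (spectral_projC x mM) Mx subrr redot0l.
rewrite setDE setTI setCK fineK //; exact: integrable_fin_num.
Qed.

Lemma diag_integral_le x M (a : R) : measurable M -> dom x -> E M x = x ->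
  (forall l, M l -> l <= a) -> q x <= a * rd x x.
Proof.
move=> mM dx Mx Ma; have [iM ic Ec Eq] := diag_integral_restrict mM dx Mx.
rewrite -lee_fin Eq -Ec; apply: le_integral => //.
by move=> l; rewrite inE => /Ma; rewrite lee_fin.
Qed.

Lemma diag_integral_ge x M (b : R) : measurable M -> dom x -> E M x = x ->
  (forall l, M l -> b <= l) -> b * rd x x <= q x.
Proof.
move=> mM dx Mx Mb; have [iM ic Ec Eq] := diag_integral_restrict mM dx Mx.
rewrite -lee_fin Eq -Ec; apply: le_integral => //.
by move=> l; rewrite inE => /Mb; rewrite lee_fin.
Qed.

Lemma eq_spectral_weight x y : (forall M, measurable M -> rd (E M x) x = rd (E M y) y) ->
  (dom x <-> dom y) /\ q x = q y.
Proof.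
move=> xy; have e (f : R -> \bar R) :
    (\int[spectral_weight x]_l f l = \int[spectral_weight y]_l f l)%E.
  by apply: eq_measure_integral => M mM _; rewrite /= !spectral_weightE ?xy.
by rewrite !spectral_domE !diag_integralE !e.
Qed.

Lemma spectral_proj_weight x L M : measurable L -> measurable M ->
  rd (E L (E M x)) (E M x) = rd (E (L `&` M) x) x.
Proof.
move=> mL mM; rewrite -spectral_proj_redot // !spectral_proj_setI //; try exact: measurableI.
by congr (rd (E _ x) x); apply/seteqP; split=> l /=; tauto.
Qed.

Lemma weight_sum_proj x M : measurable M -> weight_sum x (E M x) (E (~` M) x).
Proof.
move=> mM L mL; have cM := measurableC mM.
rewrite !spectral_proj_weight // -redotDl -spectral_proj_setU //; try exact: measurableI.
  by rewrite -setIUr setUv setIT.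
by rewrite setIACA setICr setI0.
Qed.

Lemma spectral_weightZ (c : R[i]) x M : measurable M -> `|c| = 1 ->
  rd (E M (c *: x)) (c *: x) = rd (E M x) x.
Proof.
by move=> mM c1; rewrite !spectral_proj_sqr // spectral_projZ // /rnorm normrZ c1 mul1r.
Qed.

Lemma spectral_dom0 x : dom x -> dom 0 /\ q 0 = 0.
Proof.
have w y : weight_sum y y 0.
  by move=> M mM; rewrite (spectral_proj0 mM) redot0l addr0.
move=> /(weight_sum_dom (w x))[_ d0]; split => //.
(* The instance at 0 reads [q 0 = q 0 + q 0]. *)
have := weight_sum_diag (w 0) d0; lra.
Qed.

(** Parallelogram law for the diagonal measures: those of [x + y] and [x - y] add up to twice those
    of [x] and [y], and all the integrals are nonnegative. *)
Lemma spectral_domD x y : dom x -> dom y -> dom (x + y).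
Proof.
move=> dx dy; have [d0 _] := spectral_dom0 dx.
have e : (\int[spectral_weight (x + y)%R]_l (l ^+ 2)%:E +
          \int[spectral_weight (x - y)%R]_l (l ^+ 2)%:E =
          (\int[spectral_weight x]_l (l ^+ 2)%:E +
           \int[spectral_weight x]_l (l ^+ 2)%:E) +
          (\int[spectral_weight y]_l (l ^+ 2)%:E +
           \int[spectral_weight y]_l (l ^+ 2)%:E))%E.
  have p (l : R) : setT l -> (0 <= (l ^+ 2)%:E :> \bar R)%E.
    by rewrite lee_fin sqr_ge0.
  rewrite -!ge0_integral_measure_add //.
  apply: eq_measure_integral => M mM _.
  rewrite /= /msum !big_ord_recl /= !big_ord0 !adde0 /msum.
  rewrite !big_ord_recl /= !big_ord0 !adde0.
  rewrite !spectral_weightE // -!EFinD; congr EFin.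
  rewrite spectral_projB // spectral_projD // !(redotDl, redotDr, redotNl, redotNr); ring.
move: dx dy e; rewrite !spectral_domE.
have := @integral_ge0 _ _ _ (spectral_weight (x + y)) setT (fun l => (l ^+ 2)%:E)
  (fun l _ => sqr_ge0 l).
have := @integral_ge0 _ _ _ (spectral_weight (x - y)) setT (fun l => (l ^+ 2)%:E)
  (fun l _ => sqr_ge0 l).
have := @integral_ge0 _ _ _ (spectral_weight x) setT (fun l => (l ^+ 2)%:E)
  (fun l _ => sqr_ge0 l).
have := @integral_ge0 _ _ _ (spectral_weight y) setT (fun l => (l ^+ 2)%:E)
  (fun l _ => sqr_ge0 l).
case: integral => [s| |] //; case: integral => [t| |] //; case: integral => [r| |] //;
  case: integral => [k| |] //=; rewrite ?ltry //.
Qed.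

(** Unimodular scalars cover the powers of [i] in the polarization formula. *)
Lemma spectral_domZ (c : R[i]) x : `|c| = 1 -> dom x -> dom (c *: x).
Proof. by move=> c1; have [[]] := eq_spectral_weight (fun M mM => spectral_weightZ x mM c1). Qed.

Lemma spectral_dom_proj M x : measurable M -> dom x -> dom (E M x).
Proof. by move=> mM /(weight_sum_dom (weight_sum_proj x mM))[]. Qed.

Lemma diag_integralZ (c : R[i]) x : `|c| = 1 -> q (c *: x) = q x.
Proof. by move=> c1; have [_] := eq_spectral_weight (fun M mM => spectral_weightZ x mM c1). Qed.

Lemma offdiag_integralE x y : offdiag_integral dot E id x y =
  4^-1 * ((q (x + y))%:C + ii * (q (x + ii *: y))%:C - (q (x - y))%:C
          - ii * (q (x - ii *: y))%:C).
Proof.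
have i2 : ii ^+ 2 = -1 by rewrite sqr_i.
have i3 : ii ^+ 3 = - ii by rewrite exprS i2 mulrN1.
rewrite /offdiag_integral !big_ord_recl big_ord0 /= /bump /=.
rewrite expr0 expr1 i2 i3 !scale1r !scaleN1r scaleNr !mul1r !mulN1r mulNr addr0.
by rewrite !addrA.
Qed.

(** The measures of [x + i x] and [x - i x] are both twice that of [x], so the terms with factor [i]
    cancel; their sum is the measure of [x + x], whence [4 * q x]. *)
Lemma offdiag_integral_diag x : dom x ->
  offdiag_integral dot E id x x = (q x)%:C.
Proof.
move=> dx; have [d0 q0] := spectral_dom0 dx.
have i1 : `|ii| = 1 :> R[i] by rewrite normc_def /= expr0n expr1n add0r sqrtr1.
have Ni1 : `|- ii| = 1 :> R[i] by rewrite normrN.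
have w (c : R[i]) : c = ii \/ c = - ii -> weight_sum (x + c *: x) x x.
  move=> hc M mM; rewrite spectral_projD // spectral_projZ // redotDl !redotDr.
  have -> : rd (c *: E M x) (c *: x) = rd (E M x) x.
    by rewrite -spectral_projZ // spectral_weightZ //; case: hc => ->.
  suff -> : rd (c *: E M x) x = - rd (E M x) (c *: x) by ring.
  by case: hc => ->; rewrite ?scaleNr ?redotNl ?redotNr redotil.
have wp := w ii (or_introl erefl); have wm := w (- ii) (or_intror erefl).
have dp : dom (x + ii *: x) by apply: spectral_domD => //; exact: spectral_domZ.
have dm : dom (x + - ii *: x) by apply: spectral_domD => //; exact: spectral_domZ.
have w2 : weight_sum (x + x) (x + ii *: x) (x + - ii *: x).
  move=> M mM; rewrite wp // wm // spectral_projD // redotDl redotDr; ring.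
rewrite offdiag_integralE subrr q0.
rewrite (weight_sum_diag w2); last exact: spectral_domD.
rewrite -scaleNr (weight_sum_diag wp) // (weight_sum_diag wm) //.
by rewrite rmorph0 !rmorphD /=; field.
Qed.

Lemma spectral_integral_diag x u :
  spectral_integral dot E id (x, u) -> rd u x = q x.
Proof.
by move=> [/= dx /(_ x dx)]; rewrite offdiag_integral_diag // /redot => ->.
Qed.

(** Split each vector along [M] and its complement. Both sides contain [q (E M (x + c y))]; the
    remainder does not depend on [c] and cancels in the polarization sum. *)
Lemma offdiag_integral_proj M x y : measurable M -> dom x -> dom y ->
  offdiag_integral dot E id (E M x) y = offdiag_integral dot E id x (E M y).
Proof.
move=> mM dx dy; have cM := measurableC mM.
have i1 : `|ii| = 1 :> R[i] by rewrite normc_def /= expr0n expr1n add0r sqrtr1.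
have split_ z : dom z -> q z = q (E M z) + q (E (~` M) z).
  by move=> dz; rewrite -(weight_sum_diag (weight_sum_proj z mM)).
have CM z : E (~` M) (E M z) = 0 by rewrite spectral_proj_setI // setICl spectral_proj_set0.
have l (c : R[i]) : `|c| = 1 ->
    q (E M x + c *: y) = q (E M (x + c *: y)) + q (E (~` M) y).
  move=> c1; rewrite split_; last by apply: spectral_domD; [exact: spectral_dom_proj|exact: spectral_domZ].
  rewrite !spectral_projD // !spectral_projK // !spectral_projZ // CM add0r diag_integralZ //.
have r (c : R[i]) : `|c| = 1 ->
    q (x + c *: E M y) = q (E M (x + c *: y)) + q (E (~` M) x).
  move=> c1; rewrite split_; last first.
    by apply: spectral_domD => //; apply: spectral_domZ => //; exact: spectral_dom_proj.
  by rewrite !spectral_projD // !spectral_projZ // !spectral_projK // CM scaler0 addr0.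
have N1 : `|-1| = 1 :> R[i] by rewrite normrN1.
have Ni1 : `|- ii| = 1 :> R[i] by rewrite normrN.
have one : `|1| = 1 :> R[i] by rewrite normr1.
rewrite !offdiag_integralE -!scaleNr.
rewrite -[in q (E M x + y)](scale1r y) -[in q (x + E M y)](scale1r (E M y)).
rewrite -(scaleN1r y) -(scaleN1r (E M y)).
rewrite !l // !r // !rmorphD /=; ring.
Qed.

Lemma spectral_integral_proj M x u : measurable M ->
  spectral_integral dot E id (x, u) ->
  spectral_integral dot E id (E M x, E M u).
Proof.
move=> mM [/= dx xu]; split => [|y dy] /=; first exact: spectral_dom_proj.
rewrite spectral_proj_dot // xu; last exact: spectral_dom_proj.
by rewrite offdiag_integral_proj.
Qed.

(** Shows that a spectral integral never has an empty graph. *)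
Lemma spectral_integral0 : spectral_integral dot E id (0, 0).
Proof.
have d0 : dom 0.
  apply/spectral_domE; rewrite (eq_measure_integral mzero) ?integral_measure_zero ?ltry //.
  by move=> M mM _; rewrite /= spectral_weightE // redot0r.
split=> // y dy /=; rewrite linear0l offdiag_integralE !add0r.
have i1 : `|ii| = 1 :> R[i] by rewrite normc_def /= expr0n expr1n add0r sqrtr1.
rewrite -(scaleN1r y) -scaleNr !diag_integralZ ?normrN ?normr1 //.
by ring.
Qed.

End SpectralMeasures.

(** * Commutation of [C] with the spectral projections of [S] *)

Section SpectralCommutation.
Context {R : realType} {H : completeNormedModType R[i]}.
Variable dot : {dot H for (@Num.conj R[i])}.
Hypothesis dot_norm : forall x : H, dot x x = `|x| ^+ 2.
Implicit Types (x y z u v w : H) (M : set R).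

Local Notation rd := (redot dot).
Local Notation nr := (@rnorm R H).

Variables (E : set R -> H -> H) (S : set (H * H)) (B C : H -> H).
Hypotheses (hE : spectral_measure dot E) (SE : S = spectral_integral dot E id).
Hypotheses (posS : positive_selfadjoint dot S) (resB : resolvent_of dot S B).
Hypotheses (cC : conjugation C) (CS : commutes_with C S).

Let CC x : C (C x) = x. Proof. by case: cC. Qed.

Let CB x y : C (x - y) = C x - C y. Proof. exact: conjugationB. Qed.

Let C0 : C 0 = 0. Proof. by have := CB 0 0; rewrite !subrr. Qed.

Let CD x y : C (x + y) = C x + C y.
Proof. by have [Cl _ _] := cC; have := Cl 1 1 x y; rewrite conjC1 !scale1r. Qed.

Let SB x : S (B x, x - B x). Proof. by case: resB. Qed.

Lemma conj_resolvent x : C (B x) = B (C x).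
Proof.
have [_ Bu _ _ _] := resB; have := Bu _ _ (CS (SB x)).
by rewrite -CD addrC subrK => <-.
Qed.

Lemma op_proj M x u : measurable M -> S (x, u) -> S (E M x, E M u).
Proof. by rewrite SE; exact: spectral_integral_proj. Qed.

Lemma resolvent_proj M x : measurable M -> B (E M x) = E M (B x).
Proof.
move=> mM; have [_ Bu _ _ _] := resB; have := Bu _ _ (op_proj mM (SB x)).
by rewrite -(spectral_projD hE) // addrC subrK.
Qed.

Lemma op_form_le M (a : R) x u : measurable M -> (forall l, M l -> l <= a) ->
  S (x, u) -> E M x = x -> rd u x <= a * rd x x.
Proof.
move=> mM Ma Sxu Mx; move: Sxu; rewrite SE => Sxu.
rewrite (spectral_integral_diag dot_norm hE Sxu).
by case: Sxu => dx _; apply: diag_integral_le Ma.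
Qed.

Lemma op_form_ge M (b : R) x u : measurable M -> (forall l, M l -> b <= l) ->
  S (x, u) -> E M x = x -> b * rd x x <= rd u x.
Proof.
move=> mM Mb Sxu Mx; move: Sxu; rewrite SE => Sxu.
rewrite (spectral_integral_diag dot_norm hE Sxu).
by case: Sxu => dx _; apply: diag_integral_ge Mb.
Qed.

Let linS : linear_op S. Proof. by case: posS. Qed.
Let denS x : nearly (op_dom S) x.
Proof. by case: posS => _ dS _ _; exact: nearly_dense. Qed.

Lemma positive_form x u : S (x, u) -> 0 <= rd u x.
Proof. by case: posS => _ _ _ pS; exact: positive_redot. Qed.

Lemma symmetric_form x u y v : S (x, u) -> S (y, v) -> rd u y = rd x v.
Proof.
case: posS => _ _ sS _ Sx Sy.
by rewrite /redot (selfadjoint_symmetric sS Sx Sy).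
Qed.

Lemma spectral_proj_contraction M x : measurable M -> nr (E M x) <= nr x.
Proof.
move=> mM; have := le_redot dot_norm (E M x) x.
rewrite (spectral_proj_sqr dot_norm hE) //.
have := rnorm_ge0 (E M x); have := rnorm_ge0 x; nra.
Qed.

(* Cauchy-Schwarz for the positive form <Sx, y> gives <Sx, y> <= a |x| |y| for y in
   D(S) and the range of E(M), and such y come close to Sx. *)
Lemma op_norm_le M (a : R) x u : 0 <= a -> measurable M ->
  (forall l, M l -> l <= a) -> S (x, u) -> E M x = x -> nr u <= a * nr x.
Proof.
move=> a0 mM Ma Sxu Mx.
have Mu : E M u = u.
  by have := op_proj mM Sxu; rewrite Mx; case: linS => Sf _ _ /Sf; exact.
have p0 := rnorm_ge0 x; have u0 := rnorm_ge0 u.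
have cs y v : S (y, v) -> E M y = y -> rd u y <= a * nr x * nr y.
  move=> Syv My; have g0 := rnorm_ge0 y.
  have [x0|/eqP x0] := eqVneq (nr x) 0.
    have xz : x = 0 by apply: (redot_eq0 dot_norm); rewrite -(sqr_rnorm dot_norm) x0 expr0n.
    case: linS => Sf S0 _; move: Sxu; rewrite xz => /Sf/(_ S0) ->.
    by rewrite redot0l; rewrite !mulr_ge0 // rnorm_ge0.
  have [y0|/eqP y0] := eqVneq (nr y) 0.
    have -> : y = 0 by apply: (redot_eq0 dot_norm); rewrite -(sqr_rnorm dot_norm) y0 expr0n.
    by rewrite redot0r !mulr_ge0 // rnorm_ge0.
  (* Positivity at [|y| x - |x| y] bounds twice [|x| |y| <S x, y>] by the two diagonal terms, each
     at most [a |x|^2 |y|^2]; the null cases were set apart so as to divide by [|x| |y|]. *)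
  have := positive_form (linear_opB linS
    (linear_opZ (real_complex R (nr y)) linS Sxu)
    (linear_opZ (real_complex R (nr x)) linS Syv)).
  rewrite !(redotBl, redotBr, redotZl, redotZr).
  have := op_form_le mM Ma Sxu Mx; have := op_form_le mM Ma Syv My.
  rewrite -!(sqr_rnorm dot_norm) (redotC _ v x) -(symmetric_form Sxu Syv).
  have p1 : 0 < nr x by rewrite lt_def p0 andbT; apply/eqP.
  have g1 : 0 < nr y by rewrite lt_def g0 andbT; apply/eqP.
  have pg := mulr_gt0 p1 g1.
  move=> hy hx h; rewrite -(ler_pM2l pg).
  have : nr y ^+ 2 * rd u x <= nr y ^+ 2 * (a * nr x ^+ 2).
    by rewrite ler_pM2l // exprn_gt0.
  have : nr x ^+ 2 * rd v y <= nr x ^+ 2 * (a * nr y ^+ 2).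
    by rewrite ler_pM2l // exprn_gt0.
  lra.
have [u1|u1] := eqVneq (nr u) 0; first by rewrite u1 mulr_ge0.
have u2 : 0 < nr u by rewrite lt_def u1.
suff : nr u ^+ 2 - a * nr x * nr u <= 0.
  rewrite subr_le0 expr2 ler_pM2r //.
apply: (@eps_le0 _ _ (a * nr x + nr u)) => e e0.
have [y [v Syv] uy] := denS u e0.
(* The test vector is [E M y], in the domain and in the range of [E M], and as close to [u = E M u]
   as [y] is. *)
have MMy : E M (E M y) = E M y by rewrite (spectral_projK hE).
have := cs _ _ (op_proj mM Syv) MMy.
have := spectral_proj_contraction (u - y) mM; rewrite (spectral_projB hE) // Mu => d.
have := le_redot dot_norm u (u - E M y).
rewrite redotBr -(sqr_rnorm dot_norm).
have := rnormD (E M y - u) u; rewrite subrK (rnormBC (E M y)).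
have de := le_lt_trans d uy => h1 h2 h3.
have : nr u * nr (u - E M y) <= nr u * e by rewrite ler_pM2l // ltW.
have : a * nr x * nr (E M y) <= a * nr x * (nr u + e).
  by rewrite ler_wpM2l ?mulr_ge0 //; lra.
lra.
Qed.

(** [x = B x + S (B x)], where [B x] stays in the range of [E M], so [op_norm_le] bounds the second
    term. *)
Lemma resolvent_lower M (a : R) x : 0 <= a -> measurable M ->
  (forall l, M l -> l <= a) -> E M x = x -> nr x <= (1 + a) * nr (B x).
Proof.
move=> a0 mM Ma Mx.
have := op_norm_le a0 mM Ma (SB x); rewrite -resolvent_proj // Mx => /(_ erefl).
have := rnormD (x - B x) (B x); rewrite subrK; lra.
Qed.

(** The form bound gives [(1 + b) |B x|^2 <= <x, B x>], then Cauchy-Schwarz. *)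
Lemma resolvent_upper M (b : R) x : 0 <= b -> measurable M ->
  (forall l, M l -> b <= l) -> E M x = x -> (1 + b) * nr (B x) <= nr x.
Proof.
move=> b0 mM Mb Mx.
have := op_form_ge mM Mb (SB x); rewrite -resolvent_proj // Mx => /(_ erefl).
rewrite redotBl -(sqr_rnorm dot_norm).
have := le_redot dot_norm x (B x).
have := rnorm_ge0 (B x); rewrite le_eqVlt => /orP[/eqP <-|B0].
  by move=> _ _; rewrite mulr0 rnorm_ge0.
move=> h1 h2; rewrite -(ler_pM2r B0); lra.
Qed.

(* |E(M) C y| <= (1+a) |B E(M) C y| = (1+a) |E(M) C B y| for y in the range of
   E(M'), where |B y| <= |y| / (1+b); iterate. *)
Lemma conj_proj_separated M M' (a b : R) x : 0 <= a -> a < b ->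
  measurable M -> measurable M' ->
  (forall l, M l -> l <= a) -> (forall l, M' l -> b <= l) ->
  E M (C (E M' x)) = 0.
Proof.
move=> a0 ab mM mM' Ma Mb.
pose k := (1 + a) / (1 + b).
have b1 : 0 < 1 + b by lra.
have k0 : 0 <= k by rewrite divr_ge0 //; lra.
have k1 : k < 1 by rewrite ltr_pdivrMr //; lra.
have step n y : E M' y = y -> nr (E M (C y)) <= k ^+ n * nr y.
  elim: n y => [|n IH] y My.
    rewrite expr0 mul1r; apply: le_trans (spectral_proj_contraction _ mM) _.
    by rewrite (rnorm_conjugation cC).
  have MBy : E M' (B y) = B y by rewrite -resolvent_proj // My.
  have := resolvent_lower a0 mM Ma (spectral_projK hE (C y) mM).
  rewrite resolvent_proj // -conj_resolvent.
  have := IH _ MBy; have := resolvent_upper (le_trans a0 (ltW ab)) mM' Mb My.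
  set s := nr (B y); set t := nr (E M (C (B y))) => h1 h2 h3.
  apply: le_trans h3 _; rewrite exprSr.
  apply: (@le_trans _ _ ((1 + a) * (k ^+ n * s))).
    by rewrite ler_wpM2l //; lra.
  rewrite (_ : _ * (_ * s) = k ^+ n * k * ((1 + b) * s)); last first.
    by rewrite /k; field; rewrite gt_eqF.
  by rewrite ler_wpM2l // mulr_ge0 // exprn_ge0.
apply: (redot_eq0 dot_norm); rewrite -(sqr_rnorm dot_norm).
set y := E M' x in step *.
rewrite (@eps_eq0 _ (nr (E M (C y))) (nr y)) ?expr0n // => e e0.
have : (fun n => k ^+ n) @ \oo --> (0 : R) by apply: cvg_expr; rewrite ger0_norm.
move=> /cvgrPdist_lt/(_ e e0)[N _ /(_ N (leqnn N))] /=.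
rewrite sub0r normrN ger0_norm ?exprn_ge0 // => kN.
rewrite ger0_norm ?rnorm_ge0 //.
apply: le_trans (step N y (spectral_projK hE x mM')) _.
by rewrite mulrC ler_wpM2l ?rnorm_ge0 // ltW.
Qed.

(** On the range of this projection the form of [S] is both nonnegative and at most [a |y|^2]; so
    the projection vanishes on the domain of [S], which is dense. *)
Lemma spectral_proj_negative (a : R) x : a < 0 -> E `]-oo, a] x = 0.
Proof.
move=> a0; set I := `]-oo, a]%classic.
have mI : measurable I by exact: measurable_itv.
have z y v : S (y, v) -> E I y = 0.
  move=> /(op_proj mI) Syv; apply: (redot_eq0 dot_norm).
  have := op_form_le mI (a := a) _ Syv (spectral_projK hE _ mI).
  have := positive_form Syv; have := redot_ge0 dot_norm (E I y).
  move=> h1 h2 h3; suff : rd (E I v) (E I y) <= a * rd (E I y) (E I y) by nra.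
  by apply: h3 => l; rewrite /I /= in_itv.
apply: (redot_eq0 dot_norm); rewrite (spectral_proj_redot hE) // (spectral_projK hE) // redotC.
apply: (redot_nearly0 dot_norm (denS x)) => y [v /z Iy].
by rewrite (spectral_proj_redot hE) // Iy redot0r.
Qed.

(** The open ray is the union of the closed rays from [a + 1/(n+1)], each separated from [a];
    countable additivity of [E], applied to their disjoint differences, passes to the limit. *)
Lemma conj_proj_ray (a : R) x : 0 <= a ->
  E `]-oo, a] (C (E (~` `]-oo, a]) x)) = 0.
Proof.
move=> a0; set I := `]-oo, a]%classic.
have mI : measurable I by exact: measurable_itv.
pose G (n : nat) := `[a + (n.+1%:R)^-1, +oo[%classic : set R.
have mG n : measurable (G n) by exact: measurable_itv.
have mF n : measurable (seqDU G n) by apply: measurableD => //; exact: bigsetU_measurable.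
have -> : ~` I = \bigcup_n seqDU G n.
  rewrite -seqDU_bigcup_eq; apply/seteqP; split=> l; rewrite /I /G /=.
    rewrite in_itv /= => /negP; rewrite -ltNge => al.
    have [|N hN] := @natSinv_lt R (l - a); first by rewrite subr_gt0.
    exists N => //=; rewrite in_itv /= andbT.
    by rewrite -lerBrDl ltW // hN.
  move=> [n _] /=; rewrite !in_itv /= andbT => al; apply/negP; rewrite -ltNge.
  apply: lt_le_trans al; rewrite ltrDl invr_gt0 ltr0n //.
apply: (redot_eq0 dot_norm); rewrite -(sqr_rnorm dot_norm).
rewrite (@eps_eq0 _ (nr _) 1) ?expr0n // => e e0.
have [N /(_ N (leqnn N))] := spectral_proj_cvg hE x mF (@trivIset_seqDU _ G) e0.
set s := \sum_(_ < _) _; set l := E (\bigcup__ _) x => sl.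
have s0 : E I (C s) = 0.
  rewrite /s; elim: N {s sl} => [|N IH].
    by rewrite big_ord0 C0 (spectral_proj0 hE).
  rewrite big_ord_recr /= CD (spectral_projD hE) // IH add0r.
  (* Writes the vector as an element of the range of [E (G N)], as [conj_proj_separated]
     requires. *)
  rewrite (_ : seqDU G N = G N `&` seqDU G N); last first.
    by rewrite setIC; apply/esym/setIidPl; exact: subset_seqDU.
  rewrite -(spectral_proj_setI dot_norm hE) //.
  apply: (conj_proj_separated (a := a) (b := a + (N.+1%:R)^-1)) => //.
  - by rewrite ltrDl invr_gt0 ltr0n.
  - by move=> t; rewrite /G /= in_itv /= andbT.
rewrite ger0_norm ?rnorm_ge0 // mul1r.
rewrite -[E I (C l)]subr0 -s0 -(spectral_projB hE) // -CB.
apply: le_trans (spectral_proj_contraction _ mI) _.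
by rewrite (rnorm_conjugation cC) rnormBC ltW.
Qed.

Lemma conj_proj_halfline (a : R) x : C (E `]-oo, a] (C x)) = E `]-oo, a] x.
Proof.
have [a0|a0] := leP 0 a; last first.
  by rewrite !spectral_proj_negative // C0.
have := conj_proj_ray (a := a) ^~ a0; set I := `]-oo, a]%classic => IC.
have mI : measurable I by exact: measurable_itv.
(* With [P = E I] this is [P C = P C P]. As [P] and [C] are symmetric for [rd], taking adjoints
   gives [C P = P C P], so [P] and [C] commute. *)
have PC y : E I (C y) = E I (C (E I y)).
  have := IC y; rewrite (spectral_projC dot_norm hE) // CB (spectral_projB hE) // => /eqP.
  by rewrite subr_eq0 => /eqP.
have PF y : E I (C (E I (C y))) = E I y by rewrite -PC CC.
rewrite PC; apply: (redot_eqP dot_norm) => z.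
rewrite (conjugation_redot dot_norm cC) (spectral_proj_redot hE) //.
rewrite (conjugation_redot dot_norm cC) (spectral_proj_redot hE) // PF.
by rewrite (spectral_proj_redot hE).
Qed.

(** The sets satisfying the identity form a Dynkin system, closed under disjoint unions because [C]
    is isometric; it contains the open rays, a generating class stable under intersection. *)
Lemma conj_spectral_proj M x : measurable M -> C (E M (C x)) = E M x.
Proof.
move=> mM.
have Ccvg (F : (set R)^nat) : (forall n, measurable (F n)) -> trivIset setT F ->
    (forall n x, C (E (F n) (C x)) = E (F n) x) ->
    forall x, C (E (\bigcup_n F n) (C x)) = E (\bigcup_n F n) x.
  move=> mF tF CF y; apply/subr0_eq/(redot_eq0 dot_norm).
  rewrite -(sqr_rnorm dot_norm).
  rewrite (@eps_eq0 _ (nr _) 2) ?expr0n // => e e0.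
  have [N1 h1] := spectral_proj_cvg hE (C y) mF tF e0.
  have [N2 h2] := spectral_proj_cvg hE y mF tF e0.
  have := h1 _ (leq_addr N2 N1); have := h2 _ (leq_addl N1 N2).
  set s1 := \sum_(_ < _) _; set s2 := \sum_(_ < _) _.
  have -> : s1 = C s2.
    rewrite /s1 /s2; elim: (N1 + N2)%N => [|n IH].
      by rewrite !big_ord0 C0.
    by rewrite !big_ord_recr /= IH CD CF.
  rewrite ger0_norm ?rnorm_ge0 //.
  rewrite -(rnorm_conjugation cC (s2 - _)) CB => k1 k2.
  set c := C (E _ (C y)) in k2 *; set d := E _ y in k1 *.
  have := rnorm_triangle c (C s2) d; rewrite (rnormBC c (C s2)); lra.
move: x.
have mE : @measurable _ R = <<s (@RGenOInfty.G R) >>.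
  exact: RGenOInfty.measurableE.
have : <<s (@RGenOInfty.G R) >> M by rewrite -mE.
apply: (dynkin_induction (P := [set L | forall x, C (E L (C x)) = E L x])).
- exact: mE.
- move=> _ _ [a ->] [b ->]; exists (Num.max a b).
  by apply/seteqP; split=> t /=; rewrite !in_itv /= !andbT gt_max => /andP.
- by move=> y; rewrite !(spectral_projT hE) CC.
- move=> _ [a ->] y /=; rewrite -setCitvl.
  have mI : measurable `]-oo, a]%classic by exact: measurable_itv.
  by rewrite !(spectral_projC dot_norm hE) // CB CC conj_proj_halfline.
- by move=> L mL CL y; rewrite !(spectral_projC dot_norm hE) // CB CC CL.
- by move=> F mF tF CF; apply: Ccvg.
Qed.

End SpectralCommutation.

Theorem theorem9 (R : realType) (H : completeNormedModType R[i])
    (dot : {dot H for (@Num.conj R[i])})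
    (dot_norm : forall x : H, dot x x = `|x| ^+ 2)
    (T : set (H * H)) (T_antilinear : antilinear_op T)
    (T_dense : densely_defined T) (T_closed : closed T)
    (T_normal : antilinear_normal dot T) :
  exists C : H -> H, conjugation C /\
    let c := op_fun C in
    let N := op_mul T c in
    [/\ linear_normal dot N,
        T = op_mul N c,
        op_abs dot N = anti_abs dot T,
        op_mul c (op_mul (anti_abs dot T) c) = anti_abs dot T &
        forall E : set R -> H -> H,
          spectral_measure_of dot (anti_abs dot T) E ->
          forall M : set R, measurable M -> M `<=` `[0, +oo[ ->
            C \o E M \o C = E M].
Proof.
pose A := op_mul (anti_adj dot T) T.
have lA : linear_op A := adj_mul_linear dot_norm T_antilinear T_dense.
have sA : symmetric_op dot A := @adj_mul_symmetric _ _ dot T.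
have pA : positive_op dot A := @adj_mul_positive _ _ dot T.
suff [C [cC CA [CS CE]]] : exists C : H -> H,
    [/\ conjugation C, commutes_with C A &
     commutes_with C (anti_abs dot T) /\ forall E,
       spectral_measure_of dot (anti_abs dot T) E ->
       forall M, measurable M -> forall x, C (E M (C x)) = E M x].
  exists C; split=> // c N; split.
  - exact: conj_mul_normal.
  - exact: conj_mulK.
  - by rewrite /op_abs /anti_abs adj_mul_conj_mul.
  - exact: commutes_conj_mul.
  - by move=> E hE M mM _; apply/funext => x /=; exact: CE.
(* The existence of the square root is not needed: without one, [anti_abs dot T]
   is [set0], which no spectral integral equals. *)
have [exS|noS] := pselect (exists S, positive_selfadjoint dot S /\ op_mul S S = A).
  have [pS SA] : positive_selfadjoint dot (anti_abs dot T) /\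
      op_mul (anti_abs dot T) (anti_abs dot T) = A.
    exact: (xgetPex set0 exS).
  set S := anti_abs dot T in pS SA *.
  have [lS dS sS poS] := pS.
  have sym := selfadjoint_symmetric sS.
  have onto := selfadjoint_onto dot_norm pS.
  (* [C] is built from the square root [S]; commuting with [S], it also commutes with [S S = A]. *)
  have [C [cC CS]] := exists_conjugation_commuting dot_norm lS sym poS onto.
  have [B SB] := exists_resolvent dot_norm lS sym poS onto.
  exists C; split=> //; first by rewrite -SA; exact: commutes_mul.
  split=> // E [hE SE] M mM x.
  exact: (conj_spectral_proj dot_norm hE SE pS SB cC CS).
have S0 : anti_abs dot T = set0.
  by apply: xgetPN => S hS; apply: noS; exists S.
(* Here [C] is built from [A] directly; the claims about [set0] are vacuous, since a spectral
   integral contains [(0, 0)]. *)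
have [C [cC CA]] := exists_conjugation_commuting dot_norm lA sA pA
  (adj_mul_onto dot_norm T_antilinear T_closed).
exists C; split=> //; rewrite S0; split=> [//|E [hE SE]].
by have := spectral_integral0 dot_norm hE; rewrite -SE.
Qed.
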